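(* Let $\xi\in\mathbb{C}$ satisfy $\xi^2+\xi+2=0$, and put $$\varphi_2(x)=\frac{27\,x\,(x-1)\,(49x-31-13\xi)^7}{49\,\left(7203x^3+(9947\xi-5831)x^2-(9947\xi+2009)x+275-87\xi\right)^3}.$$ Then $\varphi_2:\mathbb{P}^1\to\mathbb{P}^1$ is a covering of degree $9$ which defines a pull-back transformation from a hypergeometric equation with local exponent differences $(1/2,1/3,1/7)$ (in some order at the singular points) to a hypergeometric equation with local exponent differences $(1/2,1/7,1/7)$ (in some order). Moreover, in a neighborhood of $x=0$ the following identities hold: $${}_2F_1\!\left(\tfrac{3}{28},\tfrac{17}{28};\tfrac67;x\right)=\left(1+\tfrac{7(10-29\xi)}{8}\,x-\tfrac{343(50-29\xi)}{512}\,x^2+\tfrac{1029(362+87\xi)}{16384}\,x^3\right)^{-1/28}{}_2F_1\!\left(\tfrac1{84},\tfrac{29}{84};\tfrac67;\varphi_2(x)\right),$$ $${}_2F_1\!\left(\tfrac{3}{28},\tfrac14;\tfrac12;x\right)=\left(1-\tfrac{17-29\xi}{21}\,x-\tfrac{41+203\xi}{147}\,x^2+\tfrac{275-87\xi}{7203}\,x^3\right)^{-1/28}{}_2F_1\!\left(\tfrac1{84},\tfrac{29}{84};\tfrac12;1-\varphi_2(1/x)\right).$$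
   Context: ${}_2F_1(A,B;C;z)$ is the Gauss hypergeometric function, a solution of the hypergeometric equation $z(1-z)y''+(C-(A+B+1)z)y'-AB\,y=0$, whose local exponent differences at $z=0,1,\infty$ are (up to sign) $1-C$, $C-A-B$, $A-B$. A pull-back transformation is $z\mapsto\varphi(x)$, $y(z)\mapsto Y(x)=\theta(x)y(\varphi(x))$ with $\varphi$ a rational function and $\theta$ a product of powers of rational functions; it is said to be defined by the covering $\varphi$ (with suitable $\theta$), and it transforms the equation for $y$ into the equation for $Y$. The identities are between analytic functions near $x=0$; fractional powers of functions with value $1$ at $x=0$ denote the branch with value $1$ at $x=0$. *)

(* Defs.v *)
From Stdlib Require Import Reals Factorial List Permutation.
From Coquelicot Require Import Coquelicot.
Import ListNotations.
Open Scope C_scope.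

Fixpoint pochhammer (a : C) (n : nat) : C :=
  match n with
  | O => 1
  | S m => pochhammer a m * (a + INR m)
  end.

Definition hyp2F1_coeff (a b c : C) (n : nat) : C :=
  pochhammer a n * pochhammer b n / (pochhammer c n * INR (fact n)).

(* Meaningful where the series converges, in particular for |z| < 1;
   unspecified elsewhere. *)
Definition hyp2F1 (a b c z : C) : C :=
  @iota C_CompleteNormedModule
    (fun s => @is_pseries C_AbsRing C_NormedModule (hyp2F1_coeff a b c) z s).

(* [y] is holomorphic near [z0] and solves
   z(1-z) y'' + (c - (a+b+1) z) y' - ab y = 0 there. *)
Definition solves_hypergeometric_near (a b c z0 : C) (y : C -> C) : Prop :=
  exists y1 y2 : C -> C,
    locally z0 (fun z =>
      is_derive y z (y1 z) /\ is_derive y1 z (y2 z) /\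
      z * (1 - z) * y2 z + (c - (a + b + 1) * z) * y1 z - a * b * y z = 0).

(* At z = 0, 1 and infinity, respectively. *)
Definition exponent_differences (a b c : C) : list C :=
  [1 - c; c - a - b; a - b].

(* Exponent differences are only defined up to sign. *)
Definition has_exponent_differences (a b c : C) (l : list C) : Prop :=
  exists l' : list C,
    Permutation (exponent_differences a b c) l' /\
    Forall2 (fun u v => u = v \/ u = - v) l' l.

(* Coefficients are listed by increasing degree. *)
Definition poly_eval (p : list C) (x : C) : C :=
  fold_right (fun c r => c + x * r) 0 p.

Definition rational (f : C -> C) : Prop :=
  exists p q : list C,
    Exists (fun c : C => c <> 0) q /\
    forall x, f x = poly_eval p x / poly_eval q x.

Definition Cexp (z : C) : C :=
  (exp (Re z) * cos (Im z), exp (Re z) * sin (Im z))%R.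

(* [h] is, near [x0], a branch of the power [f ^ e]: it equals exp (e L) for
   a holomorphic branch [L] of log f.  In particular [f] does not vanish
   near [x0]. *)
Definition power_branch (f : C -> C) (e x0 : C) (h : C -> C) : Prop :=
  exists L : C -> C,
    locally x0 (fun x =>
      @ex_derive C_AbsRing C_NormedModule L x /\
      Cexp (L x) = f x /\ h x = Cexp (e * L x)).

(* [theta] is, near [x0], a branch of the product of the powers [f ^ e], for
   [(f, e)] in the list. *)
Fixpoint power_product_branch (fs : list ((C -> C) * C)) (x0 : C)
    (theta : C -> C) : Prop :=
  match fs with
  | [] => locally x0 (fun x => theta x = 1)
  | (f, e) :: fs' =>
      exists h theta' : C -> C,
        power_branch f e x0 h /\ power_product_branch fs' x0 theta' /\
        locally x0 (fun x => theta x = h x * theta' x)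
  end.

(* The covering [phi] defines, with a suitable [theta], a pull-back
   transformation of the hypergeometric equation with parameters a, b, c to
   the one with parameters a', b', c'.  As [theta] and the solutions are
   multivalued, this is expressed with arbitrary local branches, near every
   point where [phi] is holomorphic and takes a value at which the first
   equation is regular.  (Division by 0 being 0, a rational function given by
   a reduced fraction is discontinuous at its poles, hence these are
   excluded.) *)
Definition defines_pullback (phi : C -> C) (a b c a' b' c' : C) : Prop :=
  rational phi /\
  exists fs : list ((C -> C) * C),
    List.Forall (fun fe => rational (fst fe) /\ exists x, fst fe x <> 0) fs /\
    forall (x0 : C) (theta y : C -> C),
      locally x0 (fun x => @ex_derive C_AbsRing C_NormedModule phi x) ->
      phi x0 <> 0 -> phi x0 <> 1 ->
      power_product_branch fs x0 theta ->
      solves_hypergeometric_near a b c (phi x0) y ->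
      solves_hypergeometric_near a' b' c' x0 (fun x => theta x * y (phi x)).

(* [None] is the point at infinity. *)
Definition P1 : Type := option C.

Definition P1_inv (x : C) : P1 :=
  if Ceq_dec x 0 then None else Some (/ x).

(* The affine points tending to [X] while remaining distinct from [X]. *)
Definition P1_punctured (X : P1) : (C -> Prop) -> Prop :=
  match X with
  | Some x => locally' x
  | None => fun P => exists M : R, forall z : C, (M < Cmod z)%R -> P z
  end.

Definition P1_locally (X : P1) (P : P1 -> Prop) : Prop :=
  P X /\ P1_punctured X (fun z => P (Some z)).

Definition P1_continuous_at (f : P1 -> P1) (X : P1) : Prop :=
  filterlim f (P1_locally X) (P1_locally (f X)).

(* [Phi] is the self-map of the projective line given by the rational
   function [f]; the values of [f] at its poles play no role. *)
Definition P1_extension (f : C -> C) (Phi : P1 -> P1) : Prop :=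
  forall X : P1,
    filterlim (fun z => Some (f z)) (P1_punctured X) (P1_locally (Phi X)).

(* Over a neighborhood of [W], [Phi] consists of [d] disjoint sheets, given
   by the continuous sections [s 0, ..., s (d-1)]. *)
Definition evenly_covered (Phi : P1 -> P1) (d : nat) (W : P1) : Prop :=
  exists s : nat -> P1 -> P1,
    P1_locally W (fun V =>
      (forall i, (i < d)%nat -> P1_continuous_at (s i) V) /\
      (forall i j, (i < d)%nat -> (j < d)%nat -> s i V = s j V -> i = j) /\
      (forall X, Phi X = V <-> exists i, (i < d)%nat /\ X = s i V)).

(* Coverings may be branched over a finite set, [B] below. *)
Definition covering_of_degree (Phi : P1 -> P1) (d : nat) : Prop :=
  (forall X, P1_continuous_at Phi X) /\
  (forall W, exists X, Phi X = W) /\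
  exists B : list P1, forall W, ~ In W B -> evenly_covered Phi d W.

Definition phi2 (xi x : C) : C :=
  27 * x * (x - 1) * (49 * x - 31 - 13 * xi) ^ 7 /
  (49 * (7203 * x ^ 3 + (9947 * xi - 5831) * x ^ 2
         - (9947 * xi + 2009) * x + 275 - 87 * xi) ^ 3).

(* Main.v *)
Require Import Defs.
From Stdlib Require Import Reals Lra Lia Factorial List Permutation Classical Epsilon.
From Coquelicot Require Import Coquelicot.
From mathcomp Require all_boot all_algebra complex Rstruct.
Import ListNotations.
Open Scope C_scope.

(** Write phi2 = (27/49) x (x - 1) l^7 / p^3 with l linear and p cubic.  Then
    1 - phi2 = (1 + 2 xi) q^2 / p^3 and phi2' = (27/49) (1 + 2 xi) l^6 q / p^4
    with q quartic, so phi2 is branched over 0, 1 and infinity only.  Away from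
    these values the nine roots of the fibre polynomial are simple and depend
    continuously on the value.  Substituting y = p^(-1/28) Y(phi2) into the
    hypergeometric equation reduces the pull-back to polynomial identities
    modulo xi^2 + xi + 2, and the same holds for 1 - phi2(1/x) with the reversed
    polynomials.  Both sides of each identity between 2F1's then solve the same
    equation near its regular singular point 0 and take the value 1 there;
    since c > 0, there is only one such solution that is twice differentiable
    at 0. *)

(** * Complex differentiation *)

(** Why a map of this shape works: over 0 the points 0 and 1 are simple and the zero of l has order
    7; over infinity the three zeros of p have order 3; over 1 the four zeros of q are double and
    infinity is simple. The orders 7, 3, 2 turn the exponent differences 1/7, 1/3, 1/2 into 1, so
    only the simple points 0, 1 and infinity keep 1/7, 1/7 and 1/2. Riemann-Hurwitz agrees: 6 + 6 +
    4 = 2 * 9 - 2 leaves no further branching. At a zero of p the solutions of the first equation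
    acquire the exponents 1/28 and 29/28; the factor p^(-1/28) shifts them to 0 and 1, and since p
    is cubic it creates the exponent 3/28 at infinity.

    A solution is given by two successive derivatives and not by an expansion, so uniqueness at 0 is
    obtained by real analysis along rays instead of a comparison of coefficients. Likewise theta is
    an arbitrary local branch; it enters only through its logarithmic derivative, which is the same
    for all branches. *)

Lemma locally_Cmod (z : C) (P : C -> Prop) :
  locally z P <->
  exists d : R, (0 < d)%R /\ forall w, (Cmod (w - z) < d)%R -> P w.
Proof.
  split.
  - intros [e He]. exists e. split; [apply cond_pos|].
    intros w Hw. apply He, C_NormedModule_mixin_compat1, Hw.
  - intros [d [Hd Hw]].
    assert (Hd2 : (0 < d / 2)%R) by lra.
    exists (mkposreal _ Hd2). intros w Hb.
    apply Hw. apply C_NormedModule_mixin_compat2 in Hb. simpl in Hb.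
    eapply Rlt_le_trans; [exact Hb|].
    assert (sqrt 2 < 2)%R.
    { rewrite <- (sqrt_square 2) at 2 by lra. apply sqrt_lt_1; lra. }
    nra.
Qed.

(** [is_derive] uses the neighborhoods of C as an absolute ring, [locally] those of C as a product
    of two lines; [locally_C] passes from one to the other. All later estimates go through this
    form. *)
Lemma is_derive_C_eps (f : C -> C) (z l : C) :
  @is_derive C_AbsRing C_NormedModule f z l <->
  forall e : R, (0 < e)%R ->
    locally z (fun w => (Cmod (f w - f z - l * (w - z)) <= e * Cmod (w - z))%R).
Proof.
  split.
  - intros [_ H] e He.
    assert (Hz : is_filter_lim (@locally (AbsRing_UniformSpace C_AbsRing) z) z)
      by (intros P HP; exact HP).
    specialize (H z Hz (mkposreal e He)).
    apply locally_C. revert H. apply filter_imp. intros w Hw.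
    rewrite (Cmult_comm l). exact Hw.
  - intros H. split; [apply @is_linear_scal_l|].
    intros x Hx e.
    assert (E : x = z).
    { symmetry. refine (is_filter_lim_locally_unique (V := AbsRing_NormedModule C_AbsRing) _ _ _). exact Hx. }
    subst x. apply -> locally_C.
    specialize (H e (cond_pos e)). revert H. apply filter_imp. intros w Hw.
    rewrite (Cmult_comm l) in Hw. exact Hw.
Qed.

(** The product rule, and the inner function of the chain rule, take values in
    [AbsRing_NormedModule C_AbsRing]; the definitions above use [C_NormedModule]. *)
Lemma is_derive_C_AbsRing (f : C -> C) (z l : C) :
  @is_derive C_AbsRing C_NormedModule f z l <->
  @is_derive C_AbsRing (AbsRing_NormedModule C_AbsRing) f z l.
Proof.
  split; intros [[H1 H2 H3] H]; split; try exact H; split; assumption.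
Qed.

Lemma is_derive_C_eq (f : C -> C) (z l l' : C) :
  is_derive f z l -> l = l' -> is_derive f z l'.
Proof. intros H <-. exact H. Qed.

Lemma is_derive_C_unique (f : C -> C) (z l l' : C) :
  is_derive f z l -> is_derive f z l' -> l = l'.
Proof.
  intros H H'. rewrite <- (is_C_derive_unique _ _ _ H). apply is_C_derive_unique, H'.
Qed.

Lemma is_derive_C_ext_loc (f g : C -> C) (z l : C) :
  locally z (fun w => f w = g w) -> is_derive f z l -> is_derive g z l.
Proof. intros H. apply is_derive_ext_loc. apply -> locally_C. exact H. Qed.

Lemma is_derive_C_const (k z : C) : is_derive (fun _ : C => k) z (RtoC 0).
Proof. exact (is_derive_const (V := C_NormedModule) k z). Qed.

Lemma is_derive_C_id (z : C) : is_derive (fun w : C => w) z (RtoC 1).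
Proof. apply is_derive_C_AbsRing. exact (is_derive_id z). Qed.

Lemma is_derive_C_plus (f g : C -> C) (z df dg : C) :
  is_derive f z df -> is_derive g z dg ->
  is_derive (fun w => f w + g w) z (df + dg).
Proof. exact (is_derive_plus f g z df dg). Qed.

Lemma is_derive_C_minus (f g : C -> C) (z df dg : C) :
  is_derive f z df -> is_derive g z dg ->
  is_derive (fun w => f w - g w) z (df - dg).
Proof. exact (is_derive_minus f g z df dg). Qed.

Lemma is_derive_C_mult (f g : C -> C) (z df dg : C) :
  is_derive f z df -> is_derive g z dg ->
  is_derive (fun w => f w * g w) z (df * g z + f z * dg).
Proof.
  intros Hf Hg. apply is_derive_C_AbsRing in Hf, Hg. apply is_derive_C_AbsRing.
  exact (is_derive_mult f g z df dg Hf Hg Cmult_comm).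
Qed.

Lemma is_derive_C_scal (k : C) (f : C -> C) (z df : C) :
  is_derive f z df -> is_derive (fun w => k * f w) z (k * df).
Proof.
  intros Hf. eapply is_derive_C_eq.
  - apply is_derive_C_mult; [apply is_derive_C_const|exact Hf].
  - cbv beta. ring.
Qed.

Lemma is_derive_C_comp (f g : C -> C) (z df dg : C) :
  is_derive f (g z) df -> is_derive g z dg ->
  is_derive (fun w => f (g w)) z (df * dg).
Proof.
  intros Hf Hg. apply is_derive_C_AbsRing in Hg.
  rewrite Cmult_comm. exact (is_derive_comp f g z df dg Hf Hg).
Qed.

Lemma is_derive_C_pow (f : C -> C) (z df : C) (n : nat) :
  is_derive f z df ->
  is_derive (fun w => f w ^ S n) z (INR (S n) * f z ^ n * df).
Proof.
  intros Hf. induction n as [|n IH].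
  - apply is_derive_C_ext_loc with f; [apply filter_forall; intros; simpl; ring|].
    eapply is_derive_C_eq; [exact Hf|simpl; ring].
  - eapply is_derive_C_eq; [exact (is_derive_C_mult f (fun w => f w ^ S n) z _ _ Hf IH)|].
    rewrite (S_INR (S n)), RtoC_plus. simpl Cpow. ring.
Qed.

(* Stated with [locally] since on C, as an absolute ring, [continuous] refers to
   another uniform structure. *)
Lemma is_derive_C_locally (f : C -> C) (z l : C) (P : C -> Prop) :
  is_derive f z l -> locally (f z) P -> locally z (fun w => P (f w)).
Proof.
  intros Hf HP. apply locally_Cmod in HP as [d [Hd HP]].
  assert (H1 := proj1 (is_derive_C_eps _ _ _) Hf 1%R Rlt_0_1).
  set (K := (2 + Cmod l)%R).
  assert (HK : (2 <= K)%R) by (unfold K; generalize (Cmod_ge_0 l); lra).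
  assert (H2 : locally z (fun w => Cmod (w - z) < d / K)%R).
  { apply locally_Cmod. exists (d / K)%R. split; [apply Rdiv_lt_0_compat; lra|auto]. }
  generalize (filter_and _ _ H1 H2). apply filter_imp. intros w [Hw1 Hw2]. apply HP.
  replace (f w - f z) with ((f w - f z - l * (w - z)) + l * (w - z)) by ring.
  eapply Rle_lt_trans; [apply Cmod_triangle|]. rewrite Cmod_mult.
  apply Rle_lt_trans with (K * Cmod (w - z))%R.
  - unfold K. generalize (Cmod_ge_0 (w - z)). nra.
  - apply Rmult_lt_compat_l with (r := K) in Hw2; [|lra].
    replace (K * (d / K))%R with d in Hw2 by (field; lra). exact Hw2.
Qed.

Lemma locally_neq (z a : C) : z <> a -> locally z (fun w => w <> a).
Proof.
  intros H. apply locally_Cmod. exists (Cmod (z - a)). split.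
  - apply Cmod_gt_0. intros E. apply H, Ceq_minus, E.
  - intros w Hw ->. replace (a - z) with (- (z - a)) in Hw by ring.
    rewrite Cmod_opp in Hw. lra.
Qed.

Lemma is_derive_C_inv (f : C -> C) (z df : C) :
  is_derive f z df -> f z <> 0 ->
  is_derive (fun w => / f w) z (- df / f z ^ 2).
Proof.
  intros Hf Hz.
  assert (Hi : is_derive Cinv (f z) (- / f z ^ 2)).
  { set (y := f z) in *. clearbody y. clear Hf.
    apply is_derive_C_eps. intros e He.
    set (m := Cmod y). assert (Hm : (0 < m)%R) by (apply Cmod_gt_0; exact Hz).
    set (K := (2 / (m ^ 3))%R).
    assert (HK : (0 < K)%R) by (unfold K; apply Rdiv_lt_0_compat; [lra|apply pow_lt, Hm]).
    apply locally_Cmod. exists (Rmin (m / 2) (e / K)). split.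
    - apply Rmin_pos; [lra|apply Rdiv_lt_0_compat; lra].
    - intros w Hw.
      assert (H1 : (Cmod (w - y) < m / 2)%R) by (eapply Rlt_le_trans; [exact Hw|apply Rmin_l]).
      assert (H2 : (Cmod (w - y) < e / K)%R) by (eapply Rlt_le_trans; [exact Hw|apply Rmin_r]).
      assert (Hwm : (m / 2 <= Cmod w)%R).
      { assert (T := Cmod_triangle w (- (w - y))). replace (w + - (w - y)) with y in T by ring.
        rewrite Cmod_opp in T. fold m in T. lra. }
      assert (Hw0 : w <> 0) by (intros ->; rewrite Cmod_0 in Hwm; lra).
      replace (/ w - / y - - / y ^ 2 * (w - y)) with ((w - y) ^ 2 / (w * y ^ 2))
        by (field; split; assumption).
      rewrite Cmod_div, Cmod_mult, !Cmod_pow.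
      2: { apply Cmult_neq_0; [exact Hw0|apply Cpow_nz, Hz]. }
      fold m. set (d := Cmod (w - y)) in *. set (v := Cmod w) in *.
      assert (Hd : (0 <= d)%R) by apply Cmod_ge_0.
      apply Rle_trans with (K * d * d)%R.
      + unfold K. replace (2 / m ^ 3 * d * d)%R with (d ^ 2 / (m / 2 * m ^ 2))%R by (field; lra).
        apply Rmult_le_compat_l; [apply pow2_ge_0|].
        assert (0 < m ^ 2)%R by (apply pow_lt, Hm).
        apply Rinv_le_contravar; [apply Rmult_lt_0_compat; lra|].
        apply Rmult_le_compat_r; lra.
      + apply Rmult_le_compat_r; [exact Hd|].
        apply Rmult_lt_compat_l with (r := K) in H2; [|lra].
        replace (K * (e / K))%R with e in H2 by (field; lra). lra. }
  eapply is_derive_C_eq; [apply (is_derive_C_comp Cinv f z _ _ Hi Hf)|].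
  field. exact Hz.
Qed.

(** Makes the real mean value theorem and maxima on [0, 1] available for complex functions. The
    factor [k] selects a real functional: 1 gives the real part, [- Ci] the imaginary part, a
    conjugate the projection on a direction. *)
Lemma is_derive_ray (u : C -> C) (l k z : C) (t : R) :
  is_derive u (t * z) l ->
  is_derive (fun s : R => Re (k * u (s * z))) t (Re (k * (l * z))).
Proof.
  intros Hu. apply is_derive_Reals. intros e He.
  set (m := (Cmod k * Cmod z + 1)%R).
  assert (Hm : (0 < m)%R).
  { unfold m. assert (H := Rmult_le_pos _ _ (Cmod_ge_0 k) (Cmod_ge_0 z)). lra. }
  assert (He' : (0 < e / m / 2)%R) by (do 2 (apply Rdiv_lt_0_compat; try lra)).
  assert (H := proj1 (is_derive_C_eps _ _ _) Hu _ He').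
  apply locally_Cmod in H as [d [Hd H]].
  set (n := (Cmod z + 1)%R).
  assert (Hn : (0 < n)%R) by (unfold n; generalize (Cmod_ge_0 z); lra).
  assert (Hdn : (0 < d / n)%R) by (apply Rdiv_lt_0_compat; lra).
  exists (mkposreal _ Hdn). intros h Hh0 Hh. simpl in Hh.
  assert (E : (t + h)%R * z - t * z = h * z) by (rewrite RtoC_plus; ring).
  assert (Hhz : (Cmod (h * z) = Rabs h * Cmod z)%R) by (rewrite Cmod_mult, Cmod_R; reflexivity).
  specialize (H ((t + h)%R * z)). rewrite E, Hhz in H.
  assert (Hlt : (Rabs h * Cmod z < d)%R).
  { apply Rle_lt_trans with (Rabs h * n)%R.
    - apply Rmult_le_compat_l; [apply Rabs_pos|unfold n; lra].
    - apply Rmult_lt_compat_r with (r := n) in Hh; [|lra].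
      replace (d / n * n)%R with d in Hh by (field; lra). exact Hh. }
  specialize (H Hlt).
  set (D := u ((t + h)%R * z) - u (t * z) - l * (h * z)) in *.
  replace ((Re (k * u ((t + h)%R * z))%C - Re (k * u (t * z))%C) / h - Re (k * (l * z))%C)%R
    with (Re (k * D)%C / h)%R.
  2: { unfold D. generalize (u ((t + h)%R * z)) (u (t * z)). intros [a1 a2] [b1 b2].
       clear - Hh0. destruct k, l, z. simpl. field. exact Hh0. }
  assert (Hah : (0 < Rabs h)%R) by (apply Rabs_pos_lt, Hh0).
  unfold Rdiv. rewrite Rabs_mult, Rabs_inv.
  apply Rle_lt_trans with (Cmod k * (e / m / 2 * (Rabs h * Cmod z)) * / Rabs h)%R.
  - apply Rmult_le_compat_r; [left; apply Rinv_0_lt_compat, Hah|].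
    eapply Rle_trans; [apply re_le_Cmod|]. rewrite Cmod_mult.
    apply Rmult_le_compat_l; [apply Cmod_ge_0|exact H].
  - replace (Cmod k * (e / m / 2 * (Rabs h * Cmod z)) * / Rabs h)%R
      with ((Cmod k * Cmod z) * (e / m / 2))%R by (field; lra).
    apply Rlt_le_trans with (m * (e / m / 2))%R.
    + apply Rmult_lt_compat_r; [exact He'|unfold m; lra].
    + replace (m * (e / m / 2))%R with (e / 2)%R by (field; lra). lra.
Qed.

Lemma Cmod_increment_le (u v : C -> C) (z : C) (M : R) :
  (forall t : R, (0 <= t <= 1)%R ->
     is_derive u (t * z) (v (t * z)) /\ (Cmod (v (t * z)%C) <= M)%R) ->
  (Cmod (u z - u 0%C) <= M * Cmod z)%R.
Proof.
  intros H.
  (* With this [k] the projection of the increment is the square of its modulus, so a single real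
     mean value theorem suffices; one factor of the modulus is cancelled at the end. *)
  set (k := Cconj (u z - u 0)).
  destruct (MVT_gen (fun s : R => Re (k * u (s * z))) 0 1
              (fun s : R => Re (k * (v (s * z) * z)))) as [s [Hs E]].
  - rewrite Rmin_left, Rmax_right by lra. intros x Hx.
    apply is_derive_ray, H. lra.
  - rewrite Rmin_left, Rmax_right by lra. intros x Hx.
    apply derivable_continuous_pt. exists (Re (k * (v (x * z) * z))).
    apply is_derive_Reals, is_derive_ray, H. lra.
  - rewrite Rmin_left, Rmax_right in Hs by lra. cbv beta in E.
    rewrite Cmult_1_l, Cmult_0_l in E.
    destruct (H s Hs) as [_ HM].
    set (w := u z - u 0) in *.
    assert (Ew : (Re (k * u z)%C - Re (k * u 0%C)%C = Cmod w ^ 2)%R).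
    { apply RtoC_inj. rewrite RtoC_pow, <- RtoC_pow, Cmod2_conj. unfold k.
      apply injective_projections; unfold w; destruct (u z), (u 0); simpl; ring. }
    rewrite Ew in E.
    assert (Hle : (Re (k * (v (s * z) * z))%C <= Cmod w * (M * Cmod z))%R).
    { eapply Rle_trans; [apply Rle_abs|]. eapply Rle_trans; [apply re_le_Cmod|].
      rewrite !Cmod_mult. unfold k. rewrite Cmod_conj.
      apply Rmult_le_compat_l; [apply Cmod_ge_0|].
      apply Rmult_le_compat_r; [apply Cmod_ge_0|exact HM]. }
    destruct (Req_dec (Cmod w) 0) as [Z|Z].
    + rewrite Z. apply Rmult_le_pos; [|apply Cmod_ge_0].
      eapply Rle_trans; [apply Cmod_ge_0|exact HM].
    + assert (0 < Cmod w)%R by (generalize (Cmod_ge_0 w); lra). nra.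
Qed.

Lemma is_derive_0_const (u : C -> C) (r : R) :
  (forall z, (Cmod z < r)%R -> is_derive u z (RtoC 0)) ->
  forall z, (Cmod z < r)%R -> u z = u 0.
Proof.
  intros H z Hz. apply Ceq_minus, Cmod_eq_0, Rle_antisym; [|apply Cmod_ge_0].
  assert (T := Cmod_increment_le u (fun _ => RtoC 0) z 0). rewrite Rmult_0_l in T.
  apply T. intros t Ht. split; [|rewrite Cmod_0; lra].
  apply H. rewrite Cmod_mult, Cmod_R, Rabs_pos_eq by lra.
  generalize (Cmod_ge_0 z). nra.
Qed.

(** * The complex exponential *)

Lemma Cexp_plus (z w : C) : Cexp (z + w) = Cexp z * Cexp w.
Proof.
  unfold Cexp. destruct z as [a b], w as [c d]. simpl.
  rewrite exp_plus, cos_plus, sin_plus. unfold Cmult. simpl. f_equal; ring.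
Qed.

Lemma Cexp_0 : Cexp 0 = 1.
Proof. unfold Cexp. simpl. rewrite exp_0, cos_0, sin_0. unfold RtoC. f_equal; ring. Qed.

Lemma Cexp_neq_0 (z : C) : Cexp z <> 0.
Proof.
  intros E. assert (H := Cexp_plus z (- z)). rewrite E in H.
  replace (z + - z) with (RtoC 0) in H by ring. rewrite Cexp_0, Cmult_0_l in H.
  apply C1_nz, H.
Qed.

Lemma is_derive_Cexp (z : C) : is_derive Cexp z (Cexp z).
Proof.
  apply is_derive_C_eps. intros e He.
  assert (Hm : (0 < Cmod (Cexp z))%R) by apply Cmod_gt_0, Cexp_neq_0.
  (* It suffices to bound Cexp h - 1 - h for h = w - z. *)
  set (m := Cmod (Cexp z)) in *.
  (* The 10 is 2 * 5: [sqrt 2 <= 2] when passing from coordinates to the modulus, and 5 from the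
     bounds [Q1] and [Q2]. The bound 1 makes products of small terms linear. *)
  set (f := Rmin 1 (e / m / 10)).
  assert (Hf : (0 < f)%R).
  { unfold f. apply Rmin_pos; [lra|]. do 2 (apply Rdiv_lt_0_compat; try lra). }
  assert (Hf1 : (f <= 1)%R) by apply Rmin_l.
  assert (Hf2 : (f <= e / m / 10)%R) by apply Rmin_r.
  destruct (derivable_pt_lim_exp 0 f Hf) as [d1 H1].
  destruct (derivable_pt_lim_sin 0 f Hf) as [d2 H2].
  destruct (derivable_pt_lim_cos 0 f Hf) as [d3 H3].
  rewrite exp_0 in H1. rewrite cos_0, sin_0 in H2. rewrite sin_0, cos_0 in H3.
  apply locally_Cmod. exists (Rmin f (Rmin d1 (Rmin d2 d3))). split.
  { apply Rmin_pos; [exact Hf|]. destruct d1, d2, d3; simpl. repeat apply Rmin_pos; assumption. }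
  intros w Hw. set (h := w - z) in *.
  replace w with (z + h) by (unfold h; ring). rewrite Cexp_plus.
  replace (Cexp z * Cexp h - Cexp z - Cexp z * h) with (Cexp z * (Cexp h - 1 - h)) by ring.
  rewrite Cmod_mult. fold m.
  apply Rle_trans with (m * (10 * f * Cmod h))%R.
  2: { replace (m * (10 * f * Cmod h))%R with (10 * m * f * Cmod h)%R by ring.
       apply Rmult_le_compat_r; [apply Cmod_ge_0|].
       apply Rle_trans with (10 * m * (e / m / 10))%R.
       - apply Rmult_le_compat_l; lra.
       - right. field. lra. }
  apply Rmult_le_compat_l; [lra|].
  assert (Hlin : forall (F : R -> R) (l : R) (d : posreal),
    (forall k : R, k <> 0 -> Rabs k < d -> Rabs ((F (0 + k) - F 0) / k - l) < f)%R ->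
    forall k : R, (Rabs k < d)%R -> (Rabs (F k - F 0 - l * k) <= f * Rabs k)%R).
  { intros F l d HF k Hk. destruct (Req_dec k 0) as [->|K].
    - replace (F 0 - F 0 - l * 0)%R with 0%R by ring. rewrite Rabs_R0. lra.
    - specialize (HF k K Hk). rewrite Rplus_0_l in HF.
      replace (F k - F 0 - l * k)%R with (((F k - F 0) / k - l) * k)%R by (field; exact K).
      rewrite Rabs_mult. apply Rmult_le_compat_r; [apply Rabs_pos|lra]. }
  assert (Hre := re_le_Cmod h).
  assert (Him : (Rabs (Im h) <= Cmod h)%R).
  { eapply Rle_trans; [apply Rmax_r|apply Rmax_Cmod]. }
  assert (Hwf : (Cmod h < f)%R) by (eapply Rlt_le_trans; [exact Hw|apply Rmin_l]).
  assert (Hw1 : (Cmod h < d1)%R).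
  { eapply Rlt_le_trans; [exact Hw|]. eapply Rle_trans; [apply Rmin_r|apply Rmin_l]. }
  assert (Hw2 : (Cmod h < d2)%R).
  { eapply Rlt_le_trans; [exact Hw|]. eapply Rle_trans; [apply Rmin_r|].
    eapply Rle_trans; [apply Rmin_r|apply Rmin_l]. }
  assert (Hw3 : (Cmod h < d3)%R).
  { eapply Rlt_le_trans; [exact Hw|]. eapply Rle_trans; [apply Rmin_r|].
    eapply Rle_trans; [apply Rmin_r|apply Rmin_r]. }
  assert (E1 := Hlin exp 1%R d1 ltac:(rewrite exp_0; exact H1) (Re h) ltac:(lra)).
  assert (E2 := Hlin sin 1%R d2 ltac:(rewrite sin_0; exact H2) (Im h) ltac:(lra)).
  assert (E3 := Hlin cos (- 0)%R d3 ltac:(rewrite cos_0; exact H3) (Im h) ltac:(lra)).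
  rewrite exp_0, Rmult_1_l in E1. rewrite sin_0, Rmult_1_l, Rminus_0_r in E2.
  rewrite cos_0 in E3. replace (cos (Im h) - 1 - - 0 * Im h)%R with (cos (Im h) - 1)%R in E3 by ring.
  set (x := Re h) in *. set (y := Im h) in *. set (c := Cmod h) in *.
  assert (Hc : (0 <= c)%R) by apply Cmod_ge_0.
  (* The first-order remainders of exp, sin and cos; multiplying out (1 + x + p)(1 + r) and (1 + x +
     p)(y + q) gives [Eh], all of whose terms are small compared with [c]. *)
  set (p := (exp x - 1 - x)%R) in *. set (q := (sin y - y)%R) in *. set (r := (cos y - 1)%R) in *.
  assert (Eh : Cexp h - 1 - h = (p + (p + 1 + x) * r, (p + 1 + x) * q + (p + x) * y)%R).
  { unfold Cexp, p, q, r, x, y. clearbody h. destruct h as [h1 h2].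
    apply injective_projections; simpl; ring. }
  rewrite Eh. eapply Rle_trans; [apply Cmod_2Rmax|]. simpl fst. simpl snd.
  assert (S2 : (sqrt 2 <= 2)%R).
  { rewrite <- (sqrt_square 2) at 2 by lra. apply sqrt_le_1; lra. }
  assert (P1' : (Rabs p <= f * c)%R) by nra.
  assert (P2 : (Rabs q <= f * c)%R) by nra.
  assert (P3 : (Rabs r <= f * c)%R) by nra.
  assert (P4 : (Rabs (p + 1 + x) <= 3)%R).
  { eapply Rle_trans; [apply Rabs_triang|].
    assert (T := Rabs_triang p 1). rewrite Rabs_R1 in T. nra. }
  assert (P5 : (Rabs (p + x) <= 2 * c)%R).
  { eapply Rle_trans; [apply Rabs_triang|]. nra. }
  assert (Q1 : (Rabs (p + (p + 1 + x) * r) <= 5 * f * c)%R).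
  { eapply Rle_trans; [apply Rabs_triang|]. rewrite Rabs_mult.
    generalize (Rabs_pos (p + 1 + x)) (Rabs_pos r). nra. }
  assert (Q2 : (Rabs ((p + 1 + x) * q + (p + x) * y) <= 5 * f * c)%R).
  { eapply Rle_trans; [apply Rabs_triang|]. rewrite !Rabs_mult.
    generalize (Rabs_pos (p + 1 + x)) (Rabs_pos q) (Rabs_pos (p + x)) (Rabs_pos y). nra. }
  assert (Rmax (Rabs (p + (p + 1 + x) * r)) (Rabs ((p + 1 + x) * q + (p + x) * y)) <= 5 * f * c)%R
    by (apply Rmax_lub; assumption).
  assert (0 <= Rmax (Rabs (p + (p + 1 + x) * r)) (Rabs ((p + 1 + x) * q + (p + x) * y)))%R
    by (eapply Rle_trans; [apply Rabs_pos|apply Rmax_l]).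
  generalize (sqrt_pos 2). nra.
Qed.

(** * Complex power series and the logarithm *)

Definition C_pseries (a : nat -> C) (z l : C) : Prop :=
  @is_pseries C_AbsRing C_NormedModule a z l.

(** Written with [iota] so that [hyp2F1 a b c] is convertible to the case [hyp2F1_coeff a b c]. *)
Definition C_PSeries (a : nat -> C) (z : C) : C :=
  @iota C_CompleteNormedModule (C_pseries a z).

(** An explicit stand-in for a positive radius of convergence. Differentiation preserves it at the
    price of doubling [B], which is harmless because only germs at 0 matter. *)
Definition geom_bounded (a : nat -> C) (A B : R) : Prop :=
  (0 <= A)%R /\ (0 < B)%R /\ forall n, (Cmod (a n) <= A * B ^ n)%R.

Definition C_PS_derive (a : nat -> C) (n : nat) : C := INR (S n) * a (S n).

Lemma C_pseries_series (a : nat -> C) (z l : C) :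
  C_pseries a z l <-> @is_series C_AbsRing C_NormedModule (fun n => z ^ n * a n) l.
Proof.
  assert (E : forall n, @pow_n C_AbsRing z n = z ^ n).
  { induction n as [|n IH]; [reflexivity|]. simpl pow_n. rewrite IH. reflexivity. }
  split; apply is_series_ext; intros n; rewrite <- (E n); reflexivity.
Qed.

Lemma C_series_unique (a : nat -> C) (l l' : C) :
  @is_series C_AbsRing C_NormedModule a l ->
  @is_series C_AbsRing C_NormedModule a l' -> l = l'.
Proof.
  intros H H'. exact (filterlim_locally_unique (V := C_NormedModule) _ l l' H H').
Qed.

Lemma C_pseries_unique (a : nat -> C) (z l l' : C) :
  C_pseries a z l -> C_pseries a z l' -> l = l'.
Proof. exact (C_series_unique _ l l'). Qed.

Lemma C_PSeries_unique (a : nat -> C) (z l : C) :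
  C_pseries a z l -> C_PSeries a z = l.
Proof.
  intros H. apply (iota_unique (V := C_CompleteNormedModule)); [|exact H].
  intros y Hy. exact (C_pseries_unique a z y l Hy H).
Qed.

Lemma C_PSeries_correct (a : nat -> C) (A B : R) (z : C) :
  geom_bounded a A B -> (B * Cmod z < 1)%R -> C_pseries a z (C_PSeries a z).
Proof.
  intros [HA [HB H]] Hz.
  assert (E : @ex_series C_AbsRing C_NormedModule (fun n => z ^ n * a n)).
  { apply (ex_series_le (V := C_CompleteNormedModule)) with (fun n => A * (B * Cmod z) ^ n)%R.
    - intros n. change (Cmod (z ^ n * a n) <= A * (B * Cmod z) ^ n)%R.
      rewrite Cmod_mult, Cmod_pow, Rpow_mult_distr.
      replace (A * (B ^ n * Cmod z ^ n))%R with (Cmod z ^ n * (A * B ^ n))%R by ring.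
      apply Rmult_le_compat_l; [apply pow_le, Cmod_ge_0|apply H].
    - apply (@ex_series_scal_l R_AbsRing R_NormedModule A (fun n => (B * Cmod z) ^ n)%R).
      apply ex_series_geom.
      rewrite Rabs_pos_eq; [exact Hz|]. apply Rmult_le_pos; [lra|apply Cmod_ge_0]. }
  destruct E as [l Hl]. apply C_pseries_series in Hl.
  rewrite (C_PSeries_unique _ _ _ Hl). exact Hl.
Qed.

Lemma C_series_Cmod_le (a : nat -> C) (b : nat -> R) (l : C) (m : R) :
  @is_series C_AbsRing C_NormedModule a l -> is_series b m ->
  (forall n, (Cmod (a n) <= b n)%R) -> (Cmod l <= m)%R.
Proof.
  intros Ha Hb H.
  assert (Hn : filterlim (fun n => Cmod (@sum_n C_NormedModule a n)) eventually (locally (Cmod l))).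
  { eapply filterlim_comp; [exact Ha|].
    exact (@filterlim_norm C_AbsRing C_NormedModule l). }
  change (Rbar_le (Cmod l) m).
  apply (filterlim_le (F := eventually)) with
    (f := fun n => Cmod (@sum_n C_NormedModule a n)) (g := sum_n b).
  - apply filter_forall. intros n.
    induction n as [|n IH].
    + rewrite !sum_O. apply H.
    + rewrite !sum_Sn. eapply Rle_trans; [apply Cmod_triangle|].
      apply Rplus_le_compat; [exact IH|apply H].
  - exact Hn.
  - exact Hb.
Qed.

Lemma INR_le_pow2 (n : nat) : (INR (S n) <= 2 ^ n)%R.
Proof.
  induction n as [|n IH]; [simpl; lra|].
  rewrite S_INR. simpl pow. assert (1 <= 2 ^ n)%R by (apply pow_R1_Rle; lra). lra.
Qed.

Lemma geom_bounded_derive (a : nat -> C) (A B : R) :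
  geom_bounded a A B -> geom_bounded (C_PS_derive a) (A * B) (2 * B).
Proof.
  intros [HA [HB H]]. split; [nra|]. split; [lra|]. intros n.
  unfold C_PS_derive. rewrite Cmod_mult, Cmod_R, Rabs_pos_eq by apply pos_INR.
  rewrite Rpow_mult_distr.
  replace (A * B * (2 ^ n * B ^ n))%R with (2 ^ n * (A * B ^ S n))%R by (simpl; ring).
  apply Rmult_le_compat; [apply pos_INR|apply Cmod_ge_0|apply INR_le_pow2|apply H].
Qed.

(** The remainder satisfies E(n+1) = w E(n) + n z^(n-1) (w - z)^2, and n is absorbed by a power of
    2. The factor [r ^ 2] on the left avoids the exponent n - 2. *)
Lemma pow_taylor_bound (r : R) (z w : C) (n : nat) :
  (0 < r)%R -> (Cmod z <= r)%R -> (Cmod w <= r)%R ->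
  (Cmod (w ^ n - z ^ n - INR n * z ^ pred n * (w - z)) * r ^ 2
     <= (2 * r) ^ n * Cmod (w - z) ^ 2)%R.
Proof.
  intros Hr Hz Hw. set (d := Cmod (w - z)).
  assert (Hd : (0 <= d ^ 2)%R) by apply pow2_ge_0.
  induction n as [|n IH].
  - replace (w ^ 0 - z ^ 0 - INR 0 * z ^ pred 0 * (w - z)) with (RtoC 0) by (simpl; ring).
    rewrite Cmod_0. simpl. simpl in Hd. lra.
  - destruct n as [|n].
    { replace (w ^ 1 - z ^ 1 - INR 1 * z ^ pred 1 * (w - z)) with (RtoC 0) by (simpl; ring).
      rewrite Cmod_0, Rmult_0_l. apply Rmult_le_pos; [|exact Hd]. apply pow_le. lra. }
    set (E := w ^ S n - z ^ S n - INR (S n) * z ^ pred (S n) * (w - z)) in *.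
    replace (w ^ S (S n) - z ^ S (S n) - INR (S (S n)) * z ^ pred (S (S n)) * (w - z))
      with (w * E + INR (S n) * z ^ n * (w - z) ^ 2).
    2: { unfold E. rewrite (S_INR (S n)), RtoC_plus. simpl pred. simpl Cpow. ring. }
    eapply Rle_trans.
    { apply Rmult_le_compat_r; [apply pow2_ge_0|]. apply Cmod_triangle. }
    rewrite !Cmod_mult, !Cmod_pow, Cmod_R, Rabs_pos_eq by apply pos_INR. fold d.
    assert (H1 : (Cmod w * Cmod E * r ^ 2 <= r * ((2 * r) ^ S n * d ^ 2))%R).
    { rewrite Rmult_assoc. apply Rmult_le_compat; try assumption.
      - apply Cmod_ge_0.
      - apply Rmult_le_pos; [apply Cmod_ge_0|apply pow2_ge_0]. }
    assert (H2 : (INR (S n) * Cmod z ^ n * d ^ 2 * r ^ 2 <= 2 ^ n * r ^ n * d ^ 2 * r ^ 2)%R).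
    { apply Rmult_le_compat_r; [apply pow2_ge_0|]. apply Rmult_le_compat_r; [exact Hd|].
      apply Rmult_le_compat; [apply pos_INR|apply pow_le, Cmod_ge_0|apply INR_le_pow2|].
      apply pow_incr. split; [apply Cmod_ge_0|exact Hz]. }
    set (T := (2 ^ n * r ^ n * d ^ 2 * r ^ 2)%R) in *.
    assert (0 <= T)%R.
    { unfold T. apply Rmult_le_pos; [|apply pow2_ge_0]. apply Rmult_le_pos; [|exact Hd].
      apply Rmult_le_pos; apply pow_le; lra. }
    replace (r * ((2 * r) ^ S n * d ^ 2))%R with (2 * T)%R in H1
      by (unfold T; simpl pow; rewrite Rpow_mult_distr; ring).
    replace ((2 * r) ^ S (S n) * d ^ 2)%R with (4 * T)%R
      by (unfold T; simpl pow; rewrite Rpow_mult_distr; ring).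
    lra.
Qed.

Lemma is_derive_C_PSeries (a : nat -> C) (A B : R) (z : C) :
  geom_bounded a A B -> (4 * B * Cmod z < 1)%R ->
  is_derive (C_PSeries a) z (C_PSeries (C_PS_derive a) z).
Proof.
  intros HA Hz. assert (HA' := geom_bounded_derive _ _ _ HA).
  destruct (HA) as [A0 [B0 HAB]].
  (* Chosen so that B * (2 * r) = 1/2: the Taylor remainders of the terms are then dominated by a
     geometric series of ratio 1/2, whose sum gives the constant [K]. *)
  set (r := (/ (4 * B))%R).
  assert (Hr : (0 < r)%R) by (apply Rinv_0_lt_compat; lra).
  assert (HrB : (4 * B * r = 1)%R) by (unfold r; field; lra).
  assert (Hzr : (Cmod z < r)%R) by nra.
  set (K := (2 * A / r ^ 2)%R).
  assert (HK : (0 <= K)%R).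
  { unfold K. apply Rmult_le_pos; [lra|]. left. apply Rinv_0_lt_compat, pow_lt, Hr. }
  apply is_derive_C_eps. intros e He. apply locally_Cmod.
  exists (Rmin (r - Cmod z) (e / (K + 1))). split.
  { apply Rmin_pos; [lra|apply Rdiv_lt_0_compat; lra]. }
  intros w Hw.
  assert (Hw1 : (Cmod (w - z) < r - Cmod z)%R) by (eapply Rlt_le_trans; [exact Hw|apply Rmin_l]).
  assert (Hw2 : (Cmod (w - z) < e / (K + 1))%R) by (eapply Rlt_le_trans; [exact Hw|apply Rmin_r]).
  assert (Hwr : (Cmod w < r)%R).
  { replace w with ((w - z) + z) by ring. eapply Rle_lt_trans; [apply Cmod_triangle|lra]. }
  assert (Sw : C_pseries a w (C_PSeries a w)).
  { apply (C_PSeries_correct a A B); [exact HA|]. generalize (Cmod_ge_0 w). nra. }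
  assert (Sz : C_pseries a z (C_PSeries a z)).
  { apply (C_PSeries_correct a A B); [exact HA|]. generalize (Cmod_ge_0 z). nra. }
  assert (Sd : C_pseries (C_PS_derive a) z (C_PSeries (C_PS_derive a) z)).
  { apply (C_PSeries_correct _ _ _ _ HA'). generalize (Cmod_ge_0 z). nra. }
  (* Index shift that aligns the derived series with the Taylor remainders; the added term at n = 0
     vanishes through [INR 0]. *)
  assert (Sd' : @is_series C_AbsRing C_NormedModule
     (fun n => INR n * z ^ pred n * a n) (C_PSeries (C_PS_derive a) z)).
  { apply (proj1 (C_pseries_series _ _ _)) in Sd. apply (@is_series_decr_1 C_AbsRing C_NormedModule).
    replace (plus _ _) with (C_PSeries (C_PS_derive a) z).
    2: { change (@eq C (C_PSeries (C_PS_derive a) z)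
           (C_PSeries (C_PS_derive a) z + - (INR 0 * z ^ pred 0 * a 0%nat))).
         simpl INR. ring. }
    revert Sd. apply is_series_ext. intros n. unfold C_PS_derive. simpl pred.
    match goal with |- ?x = ?y => change (@eq C x y) end. ring. }
  apply (proj1 (C_pseries_series _ _ _)) in Sw, Sz.
  assert (Hs := is_series_minus _ _ _ _ (is_series_minus _ _ _ _ Sw Sz)
                 (@is_series_scal C_AbsRing C_NormedModule (w - z) _ _ Sd')).
  assert (Hb : is_series (fun n => (A * Cmod (w - z) ^ 2 / r ^ 2 * (/ 2) ^ n)%R) (K * Cmod (w - z) ^ 2)%R).
  { replace (K * Cmod (w - z) ^ 2)%R with (A * Cmod (w - z) ^ 2 / r ^ 2 * / (1 - / 2))%R
      by (unfold K; field; lra).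
    apply (@is_series_scal_l R_AbsRing R_NormedModule). apply is_series_geom.
    rewrite Rabs_pos_eq; lra. }
  assert (Hle := C_series_Cmod_le _ _ _ _ Hs Hb).
  eapply Rle_trans; [eapply Rle_trans; [|apply Hle]|].
  - right. f_equal. change (@eq C (C_PSeries a w - C_PSeries a z - C_PSeries (C_PS_derive a) z * (w - z))
      (C_PSeries a w - C_PSeries a z - (w - z) * C_PSeries (C_PS_derive a) z)). ring.
  - intros n.
    change (Cmod (w ^ n * a n - z ^ n * a n - (w - z) * (INR n * z ^ pred n * a n)) <=
      A * Cmod (w - z) ^ 2 / r ^ 2 * (/ 2) ^ n)%R.
    replace (w ^ n * a n - z ^ n * a n - (w - z) * (INR n * z ^ pred n * a n))
      with (a n * (w ^ n - z ^ n - INR n * z ^ pred n * (w - z))) by ring.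
    rewrite Cmod_mult.
    assert (T := pow_taylor_bound r z w n Hr ltac:(lra) ltac:(lra)).
    set (X := Cmod (w ^ n - z ^ n - INR n * z ^ pred n * (w - z))) in *.
    assert (HX : (0 <= X)%R) by apply Cmod_ge_0.
    assert (Hr2 : (0 < r ^ 2)%R) by (apply pow_lt, Hr).
    apply Rmult_le_reg_r with (r ^ 2)%R; [exact Hr2|].
    replace (A * Cmod (w - z) ^ 2 / r ^ 2 * (/ 2) ^ n * r ^ 2)%R
      with (A * B ^ n * ((2 * r) ^ n * Cmod (w - z) ^ 2))%R.
    2: { replace (/ 2)%R with (B * (2 * r))%R by lra. rewrite (Rpow_mult_distr B). field. lra. }
    rewrite Rmult_assoc. apply Rmult_le_compat; [apply Cmod_ge_0| |apply HAB|exact T].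
    apply Rmult_le_pos; lra.
  - set (d := Cmod (w - z)) in *. assert (0 <= d)%R by apply Cmod_ge_0.
    apply Rmult_lt_compat_r with (r := (K + 1)%R) in Hw2; [|lra].
    replace (e / (K + 1) * (K + 1))%R with e in Hw2 by (field; lra). nra.
Qed.

Lemma C_PSeries_0 (a : nat -> C) : C_PSeries a 0 = a 0%nat.
Proof. apply C_PSeries_unique. exact (@is_pseries_0 C_AbsRing C_NormedModule a). Qed.

(** The Taylor coefficients of log (1 + u). *)
Definition log_coeff (n : nat) : C :=
  match n with O => 0 | S m => (- (1)) ^ m / INR (S m) end.

Lemma INR_S_neq_0 (n : nat) : RtoC (INR (S n)) <> 0.
Proof. intros E. apply RtoC_inj in E. revert E. apply not_0_INR. lia. Qed.

Lemma geom_bounded_log_coeff : geom_bounded log_coeff 1 1.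
Proof.
  split; [lra|]. split; [lra|]. intros [|n].
  - simpl. rewrite Cmod_0. lra.
  - unfold log_coeff. rewrite Cmod_div by apply INR_S_neq_0.
    rewrite Cmod_pow, Cmod_opp, Cmod_1, Cmod_R, !pow1.
    assert (1 <= INR (S n))%R by (rewrite S_INR; generalize (pos_INR n); lra).
    rewrite Rabs_pos_eq by lra.
    apply Rmult_le_reg_r with (INR (S n)); [lra|]. field_simplify; lra.
Qed.

Lemma C_pseries_zero (a : nat -> C) (z l : C) :
  (forall n, a n = 0) -> C_pseries a z l -> l = 0.
Proof.
  intros Ha H. apply (proj1 (C_pseries_series _ _ _)) in H.
  apply Cmod_eq_0, Rle_antisym; [|apply Cmod_ge_0].
  apply (C_series_Cmod_le _ (fun _ => 0%R) _ _ H).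
  - assert (H0 : is_series (fun n => (0 * 0 ^ n)%R) (0 * / (1 - 0))%R).
    { apply (@is_series_scal_l R_AbsRing R_NormedModule). apply is_series_geom.
      rewrite Rabs_R0. lra. }
    rewrite Rmult_0_l in H0. revert H0. apply is_series_ext. intros n. apply Rmult_0_l.
  - intros n. rewrite Ha, Cmult_0_r, Cmod_0. lra.
Qed.

Lemma C_pseries_plus (a b : nat -> C) (z la lb : C) :
  C_pseries a z la -> C_pseries b z lb ->
  C_pseries (fun n => a n + b n) z (la + lb).
Proof. exact (is_pseries_plus a b z la lb). Qed.

Lemma C_pseries_minus (a b : nat -> C) (z la lb : C) :
  C_pseries a z la -> C_pseries b z lb ->
  C_pseries (fun n => a n - b n) z (la - lb).
Proof. exact (is_pseries_minus a b z la lb). Qed.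

Lemma C_pseries_scal (k : C) (a : nat -> C) (z l : C) :
  C_pseries a z l -> C_pseries (fun n => k * a n) z (k * l).
Proof. exact (is_pseries_scal k a z l (Cmult_comm z k)). Qed.

Definition C_shift (a : nat -> C) (n : nat) : C :=
  match n with O => 0 | S m => a m end.

Lemma C_pseries_shift (a : nat -> C) (z l : C) :
  C_pseries a z l -> C_pseries (C_shift a) z (z * l).
Proof. exact (is_pseries_incr_1 a z l). Qed.

Definition C_one_coeff (n : nat) : C := match n with O => 1 | S _ => 0 end.

Lemma C_pseries_one (z : C) : C_pseries C_one_coeff z 1.
Proof.
  assert (H : geom_bounded C_one_coeff 1 1).
  { split; [lra|]. split; [lra|]. intros [|n]; simpl C_one_coeff.
    - rewrite Cmod_1. simpl. lra.
    - rewrite Cmod_0, pow1. lra. }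
  apply C_pseries_series.
  apply (@is_series_decr_1 C_AbsRing C_NormedModule).
  replace (plus _ _) with (RtoC 0).
  2: { change (@eq C 0 (1 + - (z ^ 0 * C_one_coeff 0%nat))). simpl. ring. }
  assert (Z : C_pseries (fun _ => 0) 0 0).
  { apply (is_pseries_0 (K := C_AbsRing) (V := C_NormedModule)). }
  apply (proj1 (C_pseries_series _ _ _)) in Z. revert Z. apply is_series_ext.
  intros n. simpl C_one_coeff.
  match goal with |- ?x = ?y => change (@eq C x y) end. ring.
Qed.

Lemma C_log_exists :
  exists (L : C -> C) (r : R), (0 < r)%R /\ L 0 = 0 /\
    forall u, (Cmod u < r)%R -> is_derive L u (/ (1 + u)) /\ Cexp (L u) = 1 + u.
Proof.
  set (L := C_PSeries log_coeff).
  assert (HB := geom_bounded_log_coeff).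
  assert (HB' := geom_bounded_derive _ _ _ HB).
  assert (L0 : L 0 = 0) by apply C_PSeries_0.
  assert (HD : forall u, (Cmod u < / 4)%R -> 1 + u <> 0 /\ is_derive L u (/ (1 + u))).
  { intros u Hu.
    assert (H1u : 1 + u <> 0).
    { intros E. assert (Eu : u = - (1)) by (replace u with ((1 + u) - 1) by ring; rewrite E; ring).
      rewrite Eu, Cmod_opp, Cmod_1 in Hu. lra. }
    split; [exact H1u|].
    eapply is_derive_C_eq; [apply (is_derive_C_PSeries _ _ _ _ HB); lra|].
    assert (HS := C_PSeries_correct _ _ _ u HB' ltac:(lra)).
    set (l := C_PSeries (C_PS_derive log_coeff) u) in *.
    (* The derived series [l] is geometric: (1 + u) l - 1 has only zero coefficients, hence l = 1 /
       (1 + u). *)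
    assert (HS' := C_pseries_minus _ _ _ _ _ (C_pseries_plus _ _ _ _ _ HS (C_pseries_shift _ _ _ HS))
                    (C_pseries_one u)).
    apply C_pseries_zero in HS'.
    - replace (/ (1 + u)) with (l - (l + u * l - 1) / (1 + u)) by (field; exact H1u).
      rewrite HS'. field. exact H1u.
    - intros n. unfold C_PS_derive. 
      assert (E : forall m, INR (S m) * log_coeff (S m) = (- (1)) ^ m).
      { intros m. unfold log_coeff. field. apply INR_S_neq_0. }
      destruct n as [|n]; unfold C_shift, C_one_coeff; rewrite !E; simpl; ring. }
  exists L, (/ 4)%R. split; [lra|]. split; [exact L0|].
  intros u Hu. split; [apply HD, Hu|].
  (* This product has derivative 0, so that [L] is a logarithm without any inversion of [Cexp]. *)
  assert (G : Cexp (- L u) * (1 + u) = Cexp (- L 0) * (1 + 0)).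
  { apply (is_derive_0_const (fun u => Cexp (- L u) * (1 + u)) (/ 4)); [|exact Hu].
    intros z Hz. destruct (HD z Hz) as [Hz1 Hz2].
    eapply is_derive_C_eq.
    - apply (is_derive_C_mult (fun u => Cexp (- L u)) (fun u => 1 + u)).
      + apply (is_derive_C_comp Cexp (fun u => - L u)); [apply is_derive_Cexp|].
        apply (is_derive_C_ext_loc (fun u => (- (1)) * L u)).
        * apply filter_forall. intros. ring.
        * apply is_derive_C_scal, Hz2.
      + apply is_derive_C_plus; [apply is_derive_C_const|apply is_derive_C_id].
    - cbv beta. field. exact Hz1. }
  rewrite L0 in G. replace (- 0) with (RtoC 0) in G by ring.
  rewrite Cexp_0, Cplus_0_r, Cmult_1_l in G.
  assert (T : Cexp (L u) * Cexp (- L u) = 1).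
  { rewrite <- Cexp_plus, <- Cexp_0. f_equal. ring. }
  replace (1 + u) with (Cexp (L u) * (Cexp (- L u) * (1 + u))).
  - rewrite G. ring.
  - rewrite Cmult_assoc, T. ring.
Qed.

Lemma power_branch_exists (f : C -> C) (e z0 : C) :
  f z0 = 1 ->
  locally z0 (fun z => @ex_derive C_AbsRing C_NormedModule f z) ->
  exists h, power_branch f e z0 h /\ h z0 = 1.
Proof.
  intros Hf0 Hf. destruct C_log_exists as [L [r [Hr [L0 HL]]]].
  exists (fun z => Cexp (e * L (f z - 1))). split.
  - exists (fun z => L (f z - 1)).
    assert (Hn : locally z0 (fun z => (Cmod (f z - 1) < r)%R)).
    { destruct (locally_singleton _ _ Hf) as [l Hl].
      apply (is_derive_C_locally f z0 l (fun w => (Cmod (w - 1) < r)%R) Hl).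
      rewrite Hf0. apply locally_Cmod. exists r. split; [exact Hr|auto]. }
    generalize (filter_and _ _ Hf Hn). apply filter_imp.
    intros z [[l Hl] Hz]. destruct (HL _ Hz) as [H1 H2]. split; [|split].
    + exists (/ (1 + (f z - 1)) * l).
      apply (is_derive_C_comp L (fun z => f z - 1)); [exact H1|].
      eapply is_derive_C_eq; [apply is_derive_C_minus; [exact Hl|apply is_derive_C_const]|].
      ring.
    + rewrite H2. ring.
    + reflexivity.
  - cbv beta. rewrite Hf0. replace (1 - 1) with (RtoC 0) by ring.
    rewrite L0, Cmult_0_r. apply Cexp_0.
Qed.

(** * The Gauss hypergeometric series *)

Lemma pochhammer_neq_0 (c : C) (n : nat) :
  (forall m : nat, c + INR m <> 0) -> pochhammer c n <> 0.
Proof.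
  intros H. induction n as [|n IH]; [exact C1_nz|].
  apply Cmult_neq_0; [exact IH|apply H].
Qed.

Lemma INR_fact_C_neq_0 (n : nat) : RtoC (INR (fact n)) <> 0.
Proof. intros E. apply RtoC_inj in E. exact (INR_fact_neq_0 n E). Qed.

Lemma hyp2F1_coeff_S (a b c : C) (n : nat) :
  (forall m : nat, c + INR m <> 0) ->
  INR (S n) * (c + INR n) * hyp2F1_coeff a b c (S n)
  = (a + INR n) * (b + INR n) * hyp2F1_coeff a b c n.
Proof.
  intros H. unfold hyp2F1_coeff. rewrite fact_simpl, mult_INR, RtoC_mult.
  simpl pochhammer. field.
  repeat split; auto using INR_fact_C_neq_0, INR_S_neq_0, pochhammer_neq_0.
Qed.

(** The ratio (a+n)(b+n) / ((n+1)(c+n)) of consecutive coefficients is at most (a+1)(b/c+1), since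
    (a+n)/(n+1) <= a+1 and (b+n)/(c+n) <= b/c+1. *)
Lemma hyp2F1_coeff_bounded (a b c : R) :
  (0 <= a)%R -> (0 <= b)%R -> (0 < c)%R ->
  geom_bounded (hyp2F1_coeff a b c) 1 ((a + 1) * (b / c + 1)).
Proof.
  intros Ha Hb Hc.
  assert (Hbc : (0 <= b / c)%R) by (apply Rmult_le_pos; [lra|left; apply Rinv_0_lt_compat, Hc]).
  set (B := ((a + 1) * (b / c + 1))%R).
  assert (HB : (0 < B)%R) by (unfold B; apply Rmult_lt_0_compat; lra).
  split; [lra|]. split; [exact HB|].
  assert (Hn : forall m : nat, RtoC c + INR m <> 0).
  { intros m. rewrite <- RtoC_plus. intros E. apply RtoC_inj in E.
    generalize (pos_INR m). lra. }
  intros n. rewrite Rmult_1_l. induction n as [|n IH].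
  - unfold hyp2F1_coeff. simpl. replace (1 * 1 / (1 * 1)) with (RtoC 1) by field.
    rewrite Cmod_1. lra.
  - assert (E := f_equal Cmod (hyp2F1_coeff_S a b c n Hn)).
    rewrite <- !RtoC_plus, !Cmod_mult, !Cmod_R in E.
    assert (P := pos_INR n). rewrite S_INR in E.
    rewrite !Rabs_pos_eq in E by lra.
    set (x := Cmod (hyp2F1_coeff a b c n)) in *. set (y := Cmod (hyp2F1_coeff a b c (S n))) in *.
    set (m := INR n) in *. clearbody m.
    assert (Hx : (0 <= x)%R) by apply Cmod_ge_0.
    assert (H1 : (a + m <= (a + 1) * (m + 1))%R) by nra.
    assert (H2 : (b + m <= (b / c + 1) * (c + m))%R).
    { replace ((b / c + 1) * (c + m))%R with (b + m + (c + b / c * m))%R by (field; lra).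
      assert (0 <= b / c * m)%R by (apply Rmult_le_pos; lra). lra. }
    assert (H3 : ((a + m) * (b + m) <= ((a + 1) * (m + 1)) * ((b / c + 1) * (c + m)))%R)
      by (apply Rmult_le_compat; lra).
    assert (Hmc : (0 < (m + 1) * (c + m))%R) by (apply Rmult_lt_0_compat; lra).
    apply Rmult_le_reg_l with ((m + 1) * (c + m))%R; [exact Hmc|].
    rewrite E. apply Rle_trans with (((a + 1) * (m + 1)) * ((b / c + 1) * (c + m)) * x)%R.
    + apply Rmult_le_compat_r; assumption.
    + replace (((a + 1) * (m + 1)) * ((b / c + 1) * (c + m)) * x)%R
        with ((m + 1) * (c + m) * (B * x))%R by (unfold B; ring).
      apply Rmult_le_compat_l; [lra|]. simpl. apply Rmult_le_compat_l; lra.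
Qed.

Lemma hyp2F1_0 (a b c : C) : hyp2F1 a b c 0 = 1.
Proof.
  change (C_PSeries (hyp2F1_coeff a b c) 0 = 1). rewrite C_PSeries_0.
  unfold hyp2F1_coeff. simpl. field.
Qed.

Lemma hyp2F1_solves (a b c : R) :
  (0 <= a)%R -> (0 <= b)%R -> (0 < c)%R ->
  solves_hypergeometric_near a b c 0 (hyp2F1 a b c).
Proof.
  intros Ha Hb Hc.
  assert (Hn : forall m : nat, RtoC c + INR m <> 0).
  { intros m. rewrite <- RtoC_plus. intros E. apply RtoC_inj in E.
    generalize (pos_INR m). lra. }
  set (f := hyp2F1_coeff a b c).
  assert (H0 : geom_bounded f 1 ((a + 1) * (b / c + 1))) by (apply hyp2F1_coeff_bounded; assumption).
  revert H0. generalize ((a + 1) * (b / c + 1))%R. intros B H0.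
  assert (H1 := geom_bounded_derive _ _ _ H0).
  assert (H2 := geom_bounded_derive _ _ _ H1).
  assert (HB : (0 < B)%R) by apply H0.
  exists (C_PSeries (C_PS_derive f)), (C_PSeries (C_PS_derive (C_PS_derive f))).
  (* Termwise differentiation asks for 4 times the geometric bound times |z| to be below 1; for the
     first derivative that bound is [2 * B]. *)
  apply locally_Cmod. exists (/ (8 * B))%R.
  split; [apply Rinv_0_lt_compat; lra|]. intros z Hz.
  replace (z - 0) with z in Hz by ring.
  assert (Hz8 : (8 * B * Cmod z < 1)%R).
  { apply Rmult_lt_compat_l with (r := (8 * B)%R) in Hz; [|lra].
    rewrite Rinv_r in Hz by lra. exact Hz. }
  assert (Pz : (0 <= B * Cmod z)%R) by (apply Rmult_le_pos; [lra|apply Cmod_ge_0]).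
  split; [|split].
  - apply (is_derive_C_PSeries f _ _ _ H0). lra.
  - apply (is_derive_C_PSeries _ _ _ _ H1). lra.
  - assert (S0 := C_PSeries_correct _ _ _ z H0 ltac:(lra)).
    assert (S1 := C_PSeries_correct _ _ _ z H1 ltac:(lra)).
    assert (S2 := C_PSeries_correct _ _ _ z H2 ltac:(lra)).
    change (hyp2F1 a b c z) with (C_PSeries f z).
    set (y := C_PSeries f z) in *. set (y1 := C_PSeries (C_PS_derive f) z) in *.
    set (y2 := C_PSeries (C_PS_derive (C_PS_derive f)) z) in *.
    assert (T2 := C_pseries_shift _ _ _ S2).
    assert (T22 := C_pseries_shift _ _ _ T2).
    assert (T1 := C_pseries_shift _ _ _ S1).
    (* The series of z y'' - z^2 y'' + c y' - (a+b+1) z y' - a b y, each factor z being a shift; its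
       n-th coefficient vanishes by the recursion [hyp2F1_coeff_S]. *)
    assert (T := C_pseries_minus _ _ _ _ _
                  (C_pseries_minus _ _ _ _ _
                    (C_pseries_plus _ _ _ _ _ (C_pseries_minus _ _ _ _ _ T2 T22)
                       (C_pseries_scal c _ _ _ S1))
                    (C_pseries_scal (a + b + 1) _ _ _ T1))
                  (C_pseries_scal (a * b) _ _ _ S0)).
    apply C_pseries_zero in T.
    + rewrite <- T. ring.
    + intros n. cbv beta. assert (R0 := fun n => hyp2F1_coeff_S a b c n Hn). fold f in R0.
      unfold C_shift, C_PS_derive.
      assert (E := R0 n). apply Ceq_minus in E.
      etransitivity; [|exact E].
      (* The cases 0 and 1 are separate because one or both shifts contribute their initial 0
         there. *)
      destruct n as [|[|n]]; rewrite !S_INR, !RtoC_plus; simpl INR; ring.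
Qed.

(** * Uniqueness at the singular point *)

(** Only comparison with the left of [t] is assumed, since the maximum on [0, 1] may sit at the
    endpoint 1, where the derivative need not vanish. *)
Lemma derive_ge_0_right_max (f : R -> R) (t l : R) :
  (0 < t)%R -> derivable_pt_lim f t l ->
  (forall s, (0 <= s <= t)%R -> (f s <= f t)%R) -> (0 <= l)%R.
Proof.
  intros Ht Hl Hmax. apply Rnot_lt_le. intros Hneg.
  destruct (Hl (- l)%R ltac:(lra)) as [d Hd].
  set (h := (- Rmin (d / 2) t)%R).
  assert (Hdp := cond_pos d).
  assert (H1 : (Rmin (d / 2) t <= d / 2)%R) by apply Rmin_l.
  assert (H2 : (Rmin (d / 2) t <= t)%R) by apply Rmin_r.
  assert (H3 : (0 < Rmin (d / 2) t)%R) by (apply Rmin_pos; lra).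
  assert (Hh : (h < 0)%R) by (unfold h; lra).
  specialize (Hd h ltac:(lra)). rewrite Rabs_left in Hd by exact Hh.
  specialize (Hd ltac:(unfold h; lra)). apply Rabs_def2 in Hd as [Hd _].
  assert (Hs := Hmax (t + h)%R ltac:(unfold h; lra)).
  assert (0 <= (f (t + h) - f t) / h)%R.
  { replace ((f (t + h) - f t) / h)%R with ((f t - f (t + h)) * / (- h))%R by (field; lra).
    apply Rmult_le_pos; [lra|]. left. apply Rinv_0_lt_compat. lra. }
  lra.
Qed.

(* Let M be the maximum of |u'| on the segment from 0 to a small z.  Since
   |u| <= M |z|, the equation reads z u'' + c u' = O(M |z|).  At a maximum of
   |u'| the radial derivative of |u'|^2 is nonnegative, so that
   c M^2 = O(M^2 |z|) and M = 0. *)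
Lemma hypergeometric_zero_unique (a b : C) (c : R) (u : C -> C) :
  (0 < c)%R -> solves_hypergeometric_near a b c 0 u -> u 0 = 0 ->
  locally (0 : C) (fun z => u z = 0).
Proof.
  intros Hc [u1 [u2 H]] H0.
  apply locally_Cmod in H as [d [Hd H]].
  set (s := a + b + 1) in *.
  (* The 2 bounds 1 / |1 - y|, as |y| < 1/2 below. *)
  set (K := (2 * (Cmod (a * b) + Cmod (s - c)))%R).
  assert (HK : (0 <= K)%R).
  { unfold K. generalize (Cmod_ge_0 (a * b)) (Cmod_ge_0 (s - c)). lra. }
  apply locally_Cmod. exists (Rmin d (Rmin (/ 2) (c / (K + 1)))). split.
  { repeat apply Rmin_pos; try lra. apply Rdiv_lt_0_compat; lra. }
  intros z Hz. replace (z - 0) with z in Hz by ring.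
  assert (Hz1 : (Cmod z < d)%R) by (eapply Rlt_le_trans; [exact Hz|apply Rmin_l]).
  assert (Hz2 : (Cmod z < / 2)%R).
  { eapply Rlt_le_trans; [exact Hz|]. eapply Rle_trans; [apply Rmin_r|apply Rmin_l]. }
  assert (Hz3 : (Cmod z < c / (K + 1))%R).
  { eapply Rlt_le_trans; [exact Hz|]. eapply Rle_trans; [apply Rmin_r|apply Rmin_r]. }
  assert (Hray : forall t : R, (0 <= t <= 1)%R -> (Cmod (t * z) <= Cmod z)%R).
  { intros t Ht. rewrite Cmod_mult, Cmod_R, Rabs_pos_eq by lra.
    generalize (Cmod_ge_0 z). nra. }
  assert (HS : forall t : R, (0 <= t <= 1)%R ->
    is_derive u (t * z) (u1 (t * z)) /\ is_derive u1 (t * z) (u2 (t * z)) /\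
    (t * z) * (1 - t * z) * u2 (t * z) + (c - s * (t * z)) * u1 (t * z)
      - a * b * u (t * z) = 0).
  { intros t Ht. apply H. replace (t * z - 0) with (t * z) by ring.
    eapply Rle_lt_trans; [apply Hray, Ht|exact Hz1]. }
  (* [P] and [Q] are the real and imaginary parts of u' along the ray, so that [N] is |u'|^2 as a
     differentiable real function. *)
  set (P := fun t : R => Re (1 * u1 (t * z))).
  set (Q := fun t : R => Re (- Ci * u1 (t * z))).
  set (P' := fun t : R => Re (1 * (u2 (t * z) * z))).
  set (Q' := fun t : R => Re (- Ci * (u2 (t * z) * z))).
  assert (HP : forall t : R, (0 <= t <= 1)%R -> derivable_pt_lim P t (P' t)).
  { intros t Ht. apply is_derive_Reals, is_derive_ray, HS, Ht. }
  assert (HQ : forall t : R, (0 <= t <= 1)%R -> derivable_pt_lim Q t (Q' t)).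
  { intros t Ht. apply is_derive_Reals, is_derive_ray, HS, Ht. }
  set (N := (P * P + Q * Q)%F).
  assert (HN : forall t : R, (0 <= t <= 1)%R ->
    derivable_pt_lim N t ((P' t * P t + P t * P' t) + (Q' t * Q t + Q t * Q' t))%R).
  { intros t Ht. apply derivable_pt_lim_plus; apply derivable_pt_lim_mult; auto. }
  assert (NE : forall t : R, N t = (Cmod (u1 (t * z)%C) ^ 2)%R).
  { intros t. rewrite Cmod2_alt. unfold N, P, Q, plus_fct, mult_fct.
    destruct (u1 (t * z)). simpl. ring. }
  destruct (continuity_ab_maj N 0 1 ltac:(lra)) as [t [Hmax Ht]].
  { intros x Hx. apply derivable_continuous_pt. eexists. exact (HN x Hx). }
  set (M := Cmod (u1 (t * z))) in *.
  assert (HM0 : (0 <= M)%R) by apply Cmod_ge_0.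
  assert (HM : forall x : R, (0 <= x <= 1)%R -> (Cmod (u1 (x * z)%C) <= M)%R).
  { intros x Hx. specialize (Hmax x Hx). rewrite !NE in Hmax. fold M in Hmax.
    apply Rnot_lt_le. intros Hlt. generalize (Cmod_ge_0 (u1 (x * z))). nra. }
  enough (HMz : M = 0%R).
  { assert (T := Cmod_increment_le u u1 z M).
    rewrite H0, HMz, Rmult_0_l in T. replace (u z - 0) with (u z) in T by ring.
    apply Cmod_eq_0, Rle_antisym; [|apply Cmod_ge_0]. apply T.
    intros x Hx. split; [apply HS, Hx|]. rewrite <- HMz. apply HM, Hx. }
  set (y := t * z) in *.
  assert (Hu : (Cmod (u y) <= M * Cmod y)%R).
  { replace (u y) with (u y - u 0) by (rewrite H0; ring).
    apply (Cmod_increment_le u u1). intros x Hx. unfold y.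
    rewrite Cmult_assoc, <- RtoC_mult.
    assert (0 <= x * t <= 1)%R by nra. split; [apply HS|apply HM]; assumption. }
  assert (Hy : (Cmod y <= Cmod z)%R) by apply Hray, Ht.
  destruct (HS t Ht) as [_ [_ E]]. fold y in E.
  (* Splitting c - s y as c (1 - y) - (s - c) y makes 1 - y a common factor of the leading terms;
     what remains is small. *)
  set (g := y * u2 y + c * u1 y).
  assert (Eg : (1 - y) * g = a * b * u y + (s - c) * y * u1 y).
  { transitivity (a * b * u y + (s - c) * y * u1 y +
      (y * (1 - y) * u2 y + (c - s * y) * u1 y - a * b * u y)); [unfold g; ring|].
    rewrite E. ring. }
  assert (Hg : (Cmod g <= K * Cmod y * M)%R).
  { assert (H1y : (/ 2 <= Cmod (1 - y))%R).
    { assert (T := Cmod_triangle (1 - y) y). replace (1 - y + y) with (RtoC 1) in T by ring.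
      rewrite Cmod_1 in T. lra. }
    assert (T : (Cmod (1 - y) * Cmod g <=
       Cmod (a * b) * (M * Cmod y) + Cmod (s - c) * Cmod y * M)%R).
    { rewrite <- Cmod_mult, Eg. eapply Rle_trans; [apply Cmod_triangle|].
      rewrite (Cmod_mult (a * b)), (Cmod_mult ((s - c) * y)), (Cmod_mult (s - c)).
      apply Rplus_le_compat; [|apply Rle_refl].
      apply Rmult_le_compat_l; [apply Cmod_ge_0|exact Hu]. }
    generalize (Cmod_ge_0 g). unfold K. nra. }
  (* This number is t/2 times the derivative of [N] at [t], because y = t z; for t = 0 it is simply
     0. *)
  assert (Hrad : (0 <= Re (Cconj (u1 y) * (y * u2 y)))%R).
  { destruct (Req_dec t 0) as [Z|Z].
    - replace (Re (Cconj (u1 y) * (y * u2 y)))%C with 0%R; [lra|].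
      unfold y. rewrite Z. destruct (u1 (0 * z)), (u2 (0 * z)), z. simpl. ring.
    - assert (D := derive_ge_0_right_max N t _ ltac:(lra) (HN t Ht)
                     ltac:(intros x Hx; apply Hmax; lra)).
      unfold P, Q, P', Q' in D. fold y in D.
      replace (Re (Cconj (u1 y) * (y * u2 y))) with
        (t * ((Re (1 * (u2 y * z))%C * Re (1 * u1 y)%C + Re (1 * u1 y)%C * Re (1 * (u2 y * z))%C) +
         (Re (- Ci * (u2 y * z))%C * Re (- Ci * u1 y)%C
           + Re (- Ci * u1 y)%C * Re (- Ci * (u2 y * z))%C)) / 2)%R.
      + unfold Rdiv. apply Rmult_le_pos; [|lra]. apply Rmult_le_pos; [lra|exact D].
      + set (p := u1 y). set (q := u2 y). unfold y. clearbody p q.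
        destruct p as [p1 p2], q as [q1 q2], z as [z1 z2]. simpl. field. }
  (* Pairing [g] with the conjugate of u' gives the radial term plus c M^2; dropping the nonnegative
     radial term bounds c M^2 by |u'| |g|. *)
  assert (Hcm : (c * M ^ 2 <= K * Cmod y * M ^ 2)%R).
  { apply Rle_trans with (Re (Cconj (u1 y) * g)).
    - replace (Re (Cconj (u1 y) * g)) with (Re (Cconj (u1 y) * (y * u2 y))%C + c * M ^ 2)%R; [lra|].
      unfold M. rewrite Cmod2_alt. unfold g. fold y. clear. generalize (y * u2 y) (u1 y).
      intros [p1 p2] [q1 q2]. simpl. ring.
    - eapply Rle_trans; [apply Rle_abs|]. eapply Rle_trans; [apply re_le_Cmod|].
      rewrite Cmod_mult, Cmod_conj. fold M. nra. }
  assert (HKy : (K * Cmod y < c)%R).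
  { apply Rmult_lt_compat_l with (r := (K + 1)%R) in Hz3; [|lra].
    replace ((K + 1) * (c / (K + 1)))%R with c in Hz3 by (field; lra).
    generalize (Cmod_ge_0 y). nra. }
  destruct (Req_dec M 0) as [Z|Z]; [exact Z|].
  assert (0 < M ^ 2)%R by (apply pow_lt; lra). nra.
Qed.

Lemma solves_hypergeometric_near_minus (a b c z0 : C) (u v : C -> C) :
  solves_hypergeometric_near a b c z0 u -> solves_hypergeometric_near a b c z0 v ->
  solves_hypergeometric_near a b c z0 (fun z => u z - v z).
Proof.
  intros [u1 [u2 Hu]] [v1 [v2 Hv]].
  exists (fun z => u1 z - v1 z), (fun z => u2 z - v2 z).
  generalize (filter_and _ _ Hu Hv). apply filter_imp.
  intros z [[U1 [U2 U]] [V1 [V2 V]]]. split; [|split].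
  - apply is_derive_C_minus; assumption.
  - apply is_derive_C_minus; assumption.
  - match type of U with ?p = _ => match type of V with ?q = _ =>
      transitivity (p - q); [ring|rewrite U, V; ring] end end.
Qed.

Lemma solves_hypergeometric_2F1 (a b c : R) (u : C -> C) :
  (0 <= a)%R -> (0 <= b)%R -> (0 < c)%R ->
  solves_hypergeometric_near a b c 0 u -> u 0 = 1 ->
  locally (0 : C) (fun z => hyp2F1 a b c z = u z).
Proof.
  intros Ha Hb Hc Hu H1.
  assert (T := hypergeometric_zero_unique a b c (fun z => hyp2F1 a b c z - u z) Hc
    (solves_hypergeometric_near_minus _ _ _ _ _ _ (hyp2F1_solves a b c Ha Hb Hc) Hu)).
  cbv beta in T. rewrite hyp2F1_0, H1 in T. specialize (T ltac:(ring)).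
  revert T. apply filter_imp. intros z E. apply Ceq_minus, E.
Qed.

(** * Pull-back of the hypergeometric equation *)

(** Differentiating Cexp (L x) = f x forces L' = f'/f, whichever branch [L] is. All branches of the
    power thus obey the same first-order equation. *)
Lemma power_branch_derive (f : C -> C) (e x0 : C) (h : C -> C) :
  power_branch f e x0 h ->
  locally x0 (fun x => f x <> 0 /\
    forall f', is_derive f x f' -> is_derive h x (e * (f' / f x) * h x)).
Proof.
  intros [L HL]. apply locally_locally in HL. revert HL. apply filter_imp.
  intros x HL. destruct (locally_singleton _ _ HL) as [[l Hl] [E Eh]].
  assert (Hf : f x <> 0) by (rewrite <- E; apply Cexp_neq_0).
  split; [exact Hf|]. intros f' Hf'.
  assert (El : f' = f x * l).
  { apply (is_derive_C_unique f x _ _ Hf').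
    apply (is_derive_C_ext_loc (fun x => Cexp (L x))).
    - revert HL. apply filter_imp. tauto.
    - rewrite <- E. apply is_derive_C_comp; [apply is_derive_Cexp|exact Hl]. }
  apply (is_derive_C_ext_loc (fun x => Cexp (e * L x))).
  { revert HL. apply filter_imp. intros w [_ [_ Hw]]. symmetry. exact Hw. }
  eapply is_derive_C_eq.
  - apply (is_derive_C_comp Cexp (fun x => e * L x)); [apply is_derive_Cexp|].
    apply is_derive_C_scal, Hl.
  - rewrite Eh, El. field. exact Hf.
Qed.

Lemma is_derive_C_div_pow3 (f p : C -> C) (x df dp : C) :
  is_derive f x df -> is_derive p x dp -> p x <> 0 ->
  is_derive (fun x => f x / p x ^ 3) x ((df * p x - 3 * f x * dp) / p x ^ 4).
Proof.
  intros Hf Hp H.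
  eapply is_derive_C_eq.
  - apply (is_derive_C_mult f (fun x => / p x ^ 3)); [exact Hf|].
    apply (is_derive_C_inv (fun x => p x ^ 3)).
    + apply is_derive_C_pow, Hp.
    + apply Cpow_nz, H.
  - cbv beta. simpl INR. replace (RtoC (1 + 1 + 1)) with (RtoC 3) by (f_equal; ring).
    field. exact H.
Qed.

Section Pullback.

(* The map is phi = f / p^3 and theta = p^e, so that phi' = m l^6 q / p^4; the
   two equations differ by the factor k l^5 theta / p^2. *)
Variables (a b c a' b' c' e m k : C).
Variables (l l1 q q1 p p1 p2 f f1 : C -> C).
Hypothesis (Dl : forall x, is_derive l x (l1 x)) (Dq : forall x, is_derive q x (q1 x)).
Hypothesis (Dp : forall x, is_derive p x (p1 x)) (Dp1 : forall x, is_derive p1 x (p2 x)).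
Hypothesis (Df : forall x, is_derive f x (f1 x)).
(** [Hf] yields the stated form of phi'. [H2], [H1] and [H0] compare the coefficients of y''(phi),
    y'(phi) and y(phi) in the two equations, after removal of the factors l^5/p^8, l^5/p^5 and 1/p^2
    respectively. *)
Hypothesis Hf : forall x, f1 x * p x - 3 * f x * p1 x = m * l x ^ 6 * q x.
Hypothesis H2 : forall x,
  x * (1 - x) * m ^ 2 * l x ^ 7 * q x ^ 2 = k * f x * (p x ^ 3 - f x).
Hypothesis H1 : forall x,
  m * (x * (1 - x) * (6 * l1 x * q x * p x + l x * q1 x * p x - (4 - 2 * e) * p1 x * l x * q x)
       + (c' - (a' + b' + 1) * x) * l x * q x * p x)
  = k * (c * p x ^ 3 - (a + b + 1) * f x).
Hypothesis H0 : forall x,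
  x * (1 - x) * (e * (e - 1) * p1 x ^ 2 + e * p2 x * p x)
  + e * (c' - (a' + b' + 1) * x) * p1 x * p x - a' * b' * p x ^ 2
  = - (k * a * b * l x ^ 5).

Lemma pullback_solves (phi theta y : C -> C) (x0 : C) :
  locally x0 (fun x => p x <> 0 /\ phi x = f x / p x ^ 3 /\
                       is_derive theta x (e * (p1 x / p x) * theta x)) ->
  solves_hypergeometric_near a b c (phi x0) y ->
  solves_hypergeometric_near a' b' c' x0 (fun x => theta x * y (phi x)).
Proof.
  intros Hloc [y1 [y2 Hy]].
  (* [E] is theta'/theta and [E1] its derivative; [phi1] and the local [phi2] are the first two
     derivatives of [phi]. *)
  set (E := fun x => e * (p1 x / p x)).
  set (E1 := fun x => e * ((p2 x * p x - p1 x ^ 2) / p x ^ 2)).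
  set (phi1 := fun x => m * l x ^ 6 * q x / p x ^ 4).
  set (phi2 := fun x => m * l x ^ 5
    * (6 * l1 x * q x * p x + l x * q1 x * p x - 4 * l x * q x * p1 x) / p x ^ 5).
  assert (Dphi : locally x0 (fun x => is_derive phi x (phi1 x))).
  { apply locally_locally in Hloc. revert Hloc. apply filter_imp. intros x Hx.
    apply (is_derive_C_ext_loc (fun x => f x / p x ^ 3)).
    - revert Hx. apply filter_imp. intros w [_ [Hw _]]. symmetry. exact Hw.
    - unfold phi1. rewrite <- Hf. apply is_derive_C_div_pow3; [apply Df|apply Dp|].
      apply (locally_singleton _ _ Hx). }
  assert (DE : forall x, p x <> 0 -> is_derive E x (E1 x)).
  { intros x Hx. apply is_derive_C_scal. eapply is_derive_C_eq.
    - apply (is_derive_C_mult p1 (fun x => / p x)); [apply Dp1|].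
      apply is_derive_C_inv; [apply Dp|exact Hx].
    - field. exact Hx. }
  assert (Dphi1 : forall x, p x <> 0 -> is_derive phi1 x (phi2 x)).
  { intros x Hx. unfold phi1. eapply is_derive_C_eq.
    - apply (is_derive_C_mult (fun x => m * l x ^ 6 * q x) (fun x => / p x ^ 4)).
      + apply (is_derive_C_mult (fun x => m * l x ^ 6) q); [|apply Dq].
        apply is_derive_C_scal, is_derive_C_pow, Dl.
      + apply (is_derive_C_inv (fun x => p x ^ 4)); [apply is_derive_C_pow, Dp|].
        apply Cpow_nz, Hx.
    - cbv beta. unfold phi2. rewrite !S_INR, !RtoC_plus. simpl INR. field. exact Hx. }
  assert (Hyphi : locally x0 (fun x => is_derive y (phi x) (y1 (phi x)) /\
    is_derive y1 (phi x) (y2 (phi x)) /\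
    phi x * (1 - phi x) * y2 (phi x) + (c - (a + b + 1) * phi x) * y1 (phi x)
      - a * b * y (phi x) = 0)).
  { apply (is_derive_C_locally phi x0 _ _ (locally_singleton _ _ Dphi) Hy). }
  exists (fun x => theta x * (E x * y (phi x) + phi1 x * y1 (phi x))),
    (fun x => theta x * (E x * (E x * y (phi x) + phi1 x * y1 (phi x))
       + (E1 x * y (phi x) + E x * (phi1 x * y1 (phi x))
          + (phi2 x * y1 (phi x) + phi1 x * (phi1 x * y2 (phi x)))))).
  generalize (filter_and _ _ Hloc (filter_and _ _ Dphi Hyphi)). apply filter_imp.
  intros x [[Hp [Ephi Dth]] [Dph [Dy [Dy1 EQ]]]].
  assert (Dyp := is_derive_C_comp y phi x _ _ Dy Dph).
  assert (Dyp1 := is_derive_C_comp y1 phi x _ _ Dy1 Dph).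
  split; [|split].
  - eapply is_derive_C_eq; [apply (is_derive_C_mult theta (fun x => y (phi x))); eassumption|].
    unfold E. ring.
  - eapply is_derive_C_eq.
    + apply (is_derive_C_mult theta (fun x => E x * y (phi x) + phi1 x * y1 (phi x)));
        [exact Dth|].
      apply (is_derive_C_plus (fun x => E x * y (phi x)) (fun x => phi1 x * y1 (phi x))).
      * apply (is_derive_C_mult E (fun x => y (phi x))); [apply DE, Hp|exact Dyp].
      * apply (is_derive_C_mult phi1 (fun x => y1 (phi x))); [apply Dphi1, Hp|exact Dyp1].
    + cbv beta. fold (E x). ring.
  - cbv beta.
    assert (I2 := H2 x). assert (I1 := H1 x). assert (I0 := H0 x).
    apply Ceq_minus in I2, I1, I0.
    set (Y := y (phi x)) in *. set (Y1 := y1 (phi x)) in *. set (Y2 := y2 (phi x)) in *.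
    rewrite Ephi in EQ.
    (* The transformed equation is this explicit combination of the three polynomial identities and
       of the original equation at phi x, each brought to the form [_ = 0]. *)
    match type of I2 with ?i2 = _ => match type of I1 with ?i1 = _ =>
    match type of I0 with ?i0 = _ => match type of EQ with ?eq = _ =>
      transitivity (theta x * (l x ^ 5 / p x ^ 8 * Y2 * i2 + l x ^ 5 / p x ^ 5 * Y1 * i1
        + Y / p x ^ 2 * i0 + k * l x ^ 5 / p x ^ 2 * eq)) end end end end.
    + unfold E, E1, phi1, phi2. field. exact Hp.
    + rewrite I2, I1, I0, EQ. ring.
Qed.

End Pullback.

(** * The polynomials attached to [phi2] and their identities *)

Definition cubic (xi x : C) : C :=
  7203 * x ^ 3 + (9947 * xi - 5831) * x ^ 2 - (9947 * xi + 2009) * x + 275 - 87 * xi.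
Definition cubic1 (xi x : C) : C :=
  21609 * x ^ 2 + 2 * (9947 * xi - 5831) * x - (9947 * xi + 2009).
Definition cubic2 (xi x : C) : C := 43218 * x + 2 * (9947 * xi - 5831).
Definition linear_factor (xi x : C) : C := 49 * x - 31 - 13 * xi.
Definition quartic (xi x : C) : C :=
  1058841 * x ^ 4 + (412972 * xi - 1911196) * x ^ 3 + (528906 - 619458 * xi) * x ^ 2
  + (212076 * xi + 326244) * x - (2795 * xi + 393).
Definition quartic1 (xi x : C) : C :=
  4235364 * x ^ 3 + 3 * (412972 * xi - 1911196) * x ^ 2 + 2 * (528906 - 619458 * xi) * x
  + (212076 * xi + 326244).
Definition numer (xi x : C) : C := 27 / 49 * (x * (x - 1) * linear_factor xi x ^ 7).
Definition numer1 (xi x : C) : C :=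
  27 / 49 * ((2 * x - 1) * linear_factor xi x ^ 7 + 343 * x * (x - 1) * linear_factor xi x ^ 6).


(* The reversed polynomials describe 1 - phi2 (1 / x) = numer_rev / cubic_rev^3. *)
Definition cubic_rev (xi x : C) : C :=
  7203 + (9947 * xi - 5831) * x - (9947 * xi + 2009) * x ^ 2 + (275 - 87 * xi) * x ^ 3.
Definition cubic_rev1 (xi x : C) : C :=
  9947 * xi - 5831 - 2 * (9947 * xi + 2009) * x + 3 * (275 - 87 * xi) * x ^ 2.
Definition cubic_rev2 (xi x : C) : C :=
  6 * (275 - 87 * xi) * x - 2 * (9947 * xi + 2009).
Definition linear_rev (xi x : C) : C := 49 - (31 + 13 * xi) * x.
Definition quartic_rev (xi x : C) : C :=
  1058841 + (412972 * xi - 1911196) * x + (528906 - 619458 * xi) * x ^ 2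
  + (212076 * xi + 326244) * x ^ 3 - (2795 * xi + 393) * x ^ 4.
Definition quartic_rev1 (xi x : C) : C :=
  412972 * xi - 1911196 + 2 * (528906 - 619458 * xi) * x
  + 3 * (212076 * xi + 326244) * x ^ 2 - 4 * (2795 * xi + 393) * x ^ 3.
Definition numer_rev (xi x : C) : C := (1 + 2 * xi) * (x * quartic_rev xi x ^ 2).
Definition numer_rev1 (xi x : C) : C :=
  (1 + 2 * xi) * (quartic_rev xi x ^ 2 + 2 * x * quartic_rev xi x * quartic_rev1 xi x).

(** The derivative is built by unification. The constant case precedes the sums and products, so
    coefficients in [xi] are treated as a whole. *)
Ltac derive_polynomial :=
  match goal with
  | |- is_derive (fun x => x) _ _ => apply is_derive_C_id
  | |- is_derive (fun _ => ?k) _ _ => apply (is_derive_C_const k)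
  | |- is_derive (fun x => @?f x + @?g x) _ _ =>
      apply (is_derive_C_plus f g); derive_polynomial
  | |- is_derive (fun x => @?f x - @?g x) _ _ =>
      apply (is_derive_C_minus f g); derive_polynomial
  | |- is_derive (fun x => ?k * @?f x) _ _ =>
      apply (is_derive_C_scal k f); derive_polynomial
  | |- is_derive (fun x => @?f x * @?g x) _ _ =>
      apply (is_derive_C_mult f g); derive_polynomial
  | |- is_derive (fun x => @?f x ^ S ?n) _ _ =>
      eapply (is_derive_C_pow f _ _ n); derive_polynomial
  end.

Ltac solve_derive :=
  intros; eapply is_derive_C_eq;
  [derive_polynomial
  |cbv beta; rewrite ?S_INR, ?RtoC_plus; simpl INR; simpl Cpow; try field].

Lemma is_derive_linear_factor (xi x : C) : is_derive (linear_factor xi) x (RtoC 49).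
Proof. unfold linear_factor. solve_derive. Qed.
Lemma is_derive_cubic (xi x : C) : is_derive (cubic xi) x (cubic1 xi x).
Proof. unfold cubic, cubic1. solve_derive. Qed.
Lemma is_derive_cubic1 (xi x : C) : is_derive (cubic1 xi) x (cubic2 xi x).
Proof. unfold cubic1, cubic2. solve_derive. Qed.
Lemma is_derive_quartic (xi x : C) : is_derive (quartic xi) x (quartic1 xi x).
Proof. unfold quartic, quartic1. solve_derive. Qed.
Lemma is_derive_numer (xi x : C) : is_derive (numer xi) x (numer1 xi x).
Proof. unfold numer, numer1, linear_factor. solve_derive. Qed.
Lemma is_derive_linear_rev (xi x : C) : is_derive (linear_rev xi) x (- (31 + 13 * xi)).
Proof. unfold linear_rev. solve_derive. Qed.
Lemma is_derive_cubic_rev (xi x : C) : is_derive (cubic_rev xi) x (cubic_rev1 xi x).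
Proof. unfold cubic_rev, cubic_rev1. solve_derive. Qed.
Lemma is_derive_cubic_rev1 (xi x : C) : is_derive (cubic_rev1 xi) x (cubic_rev2 xi x).
Proof. unfold cubic_rev1, cubic_rev2. solve_derive. Qed.
Lemma is_derive_quartic_rev (xi x : C) : is_derive (quartic_rev xi) x (quartic_rev1 xi x).
Proof. unfold quartic_rev, quartic_rev1. solve_derive. Qed.
Lemma is_derive_numer_rev (xi x : C) : is_derive (numer_rev xi) x (numer_rev1 xi x).
Proof. unfold numer_rev, numer_rev1, quartic_rev, quartic_rev1. solve_derive. Qed.

(** The terms 27 * 7^12 * x^9 cancel and leave degree 8: infinity is the ninth, simple point over 1.
    The constant [1 + 2 * xi] is a square root of -7. *)
Lemma cubic_minus_numer (xi x : C) : xi ^ 2 = - xi - 2 ->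
  cubic xi x ^ 3 - numer xi x = (1 + 2 * xi) * quartic xi x ^ 2.
Proof. intros H. unfold cubic, numer, quartic, linear_factor. field [H]. Qed.

Lemma numer_derive (xi x : C) : xi ^ 2 = - xi - 2 ->
  numer1 xi x * cubic xi x - 3 * numer xi x * cubic1 xi x
  = 27 / 49 * (1 + 2 * xi) * linear_factor xi x ^ 6 * quartic xi x.
Proof. intros H. unfold numer1, cubic, numer, cubic1, quartic, linear_factor. field [H]. Qed.

Lemma cubic_rev_minus_numer_rev (xi x : C) : xi ^ 2 = - xi - 2 ->
  cubic_rev xi x ^ 3 - numer_rev xi x = 27 / 49 * ((1 - x) * linear_rev xi x ^ 7).
Proof. intros H. unfold cubic_rev, numer_rev, quartic_rev, linear_rev. field [H]. Qed.

Lemma numer_rev_derive (xi x : C) : xi ^ 2 = - xi - 2 ->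
  numer_rev1 xi x * cubic_rev xi x - 3 * numer_rev xi x * cubic_rev1 xi x
  = 27 / 49 * (1 + 2 * xi) * linear_rev xi x ^ 6 * quartic_rev xi x.
Proof.
  intros H.
  unfold numer_rev1, cubic_rev, numer_rev, cubic_rev1, quartic_rev, quartic_rev1, linear_rev.
  field [H].
Qed.

Lemma pullback_phi2 (xi : C) (phi theta y : C -> C) (x0 : C) : xi ^ 2 = - xi - 2 ->
  locally x0 (fun x => cubic xi x <> 0 /\ phi x = numer xi x / cubic xi x ^ 3 /\
    is_derive theta x (- (1 / 28) * (cubic1 xi x / cubic xi x) * theta x)) ->
  solves_hypergeometric_near (1 / 84) (29 / 84) (6 / 7) (phi x0) y ->
  solves_hypergeometric_near (3 / 28) (17 / 28) (6 / 7) x0 (fun x => theta x * y (phi x)).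
Proof.
  intros H.
  (* Here k = -m, because [numer] contains x (x - 1) where the equation has x (1 - x). In [H0] the
     terms of degree 6 cancel, as 3 e + 3/28 = 0. *)
  apply (pullback_solves _ _ _ _ _ _ (- (1 / 28)) (27 / 49 * (1 + 2 * xi)) (- (27 / 49 * (1 + 2 * xi)))
    (linear_factor xi) (fun _ => RtoC 49) (quartic xi) (quartic1 xi) (cubic xi) (cubic1 xi) (cubic2 xi)
    (numer xi) (numer1 xi)).
  - apply is_derive_linear_factor.
  - apply is_derive_quartic.
  - apply is_derive_cubic.
  - apply is_derive_cubic1.
  - apply is_derive_numer.
  - intros x. apply numer_derive, H.
  - intros x. rewrite cubic_minus_numer by exact H. unfold numer. field [H].
  - intros x. unfold cubic, numer, quartic, quartic1, linear_factor, cubic1. field [H].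
  - intros x. unfold cubic, linear_factor, cubic1, cubic2. field [H].
Qed.

Lemma pullback_phi2_inv (xi : C) (phi theta y : C -> C) (x0 : C) : xi ^ 2 = - xi - 2 ->
  locally x0 (fun x => cubic_rev xi x <> 0 /\
    phi x = numer_rev xi x / cubic_rev xi x ^ 3 /\
    is_derive theta x (- (1 / 28) * (cubic_rev1 xi x / cubic_rev xi x) * theta x)) ->
  solves_hypergeometric_near (1 / 84) (29 / 84) (1 / 2) (phi x0) y ->
  solves_hypergeometric_near (3 / 28) (1 / 4) (1 / 2) x0 (fun x => theta x * y (phi x)).
Proof.
  intros H.
  (* Now k = m: x comes from [numer_rev] and 1 - x from [cubic_rev_minus_numer_rev], with no change
     of sign. *)
  apply (pullback_solves _ _ _ _ _ _ (- (1 / 28)) (27 / 49 * (1 + 2 * xi)) (27 / 49 * (1 + 2 * xi))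
    (linear_rev xi) (fun _ => - (31 + 13 * xi)) (quartic_rev xi) (quartic_rev1 xi)
    (cubic_rev xi) (cubic_rev1 xi) (cubic_rev2 xi) (numer_rev xi) (numer_rev1 xi)).
  - apply is_derive_linear_rev.
  - apply is_derive_quartic_rev.
  - apply is_derive_cubic_rev.
  - apply is_derive_cubic_rev1.
  - apply is_derive_numer_rev.
  - intros x. apply numer_rev_derive, H.
  - intros x. rewrite cubic_rev_minus_numer_rev by exact H. unfold numer_rev. field [H].
  - intros x. unfold cubic_rev, numer_rev, quartic_rev, quartic_rev1, linear_rev, cubic_rev1.
    field [H].
  - intros x. unfold cubic_rev, linear_rev, cubic_rev1, cubic_rev2. field [H].
Qed.

(** * Fibres of rational maps *)

Definition root_product (r : list C) (x : C) : C :=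
  fold_right (fun a acc => (x - a) * acc) 1 r.

(** * The fundamental theorem of algebra, transferred from the mathcomp complex numbers to C *)

Module FundamentalTheoremOfAlgebra.
Import all_boot all_algebra complex Rstruct.
Import GRing.Theory.

Notation Ri := (complex R).
Definition to_C (z : Ri) : C := let: Complex a b := z in (a, b).
Definition of_C (z : C) : Ri := Complex z.1 z.2.

Lemma to_CK z : to_C (of_C z) = z. Proof. by case: z. Qed.
Lemma to_CD (z w : Ri) : to_C (GRing.add z w) = Cplus (to_C z) (to_C w).
Proof. by case: z; case: w. Qed.
Lemma to_CN (z : Ri) : to_C (GRing.opp z) = Copp (to_C z).
Proof. by case: z. Qed.
Lemma to_CM (z w : Ri) : to_C (GRing.mul z w) = Cmult (to_C z) (to_C w).
Proof. by case: z => a b; case: w. Qed.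

Lemma to_C_horner (s : seq Ri) x :
  to_C (horner_rec s x) = poly_eval (map to_C s) (to_C x).
Proof. elim: s => [|c s IHs] //=. by rewrite to_CD to_CM IHs Cplus_comm Cmult_comm. Qed.

Lemma to_C_prod (r : seq Ri) x :
  to_C (\prod_(z <- r) (x - z))%R = root_product (map to_C r) (to_C x).
Proof.
elim: r => [|z r IHr] /=; first by rewrite big_nil.
by rewrite big_cons to_CM IHr to_CD to_CN.
Qed.

Lemma split_poly (s : seq C) (n : nat) :
  size s = n.+1 -> List.nth n s (RtoC 0) <> RtoC 0 ->
  exists r : seq C, size r = n /\
    forall x, poly_eval s x = Cmult (List.nth n s (RtoC 0)) (root_product r x).
Proof.
move=> ss nz.
have nthE (t : seq C) k : List.nth k t (RtoC 0) = seq.nth (RtoC 0) t k.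
  by elim: t k => [|a t IHt] [|k] //=.
rewrite nthE in nz *.
set t := map of_C s; have st : map to_C t = s.
  by rewrite /t -map_comp -[RHS]map_id; apply: eq_map => z; exact: to_CK.
have szt : size t = n.+1 by rewrite size_map.
have zt : to_C (t`_n)%R = seq.nth (RtoC 0) s n.
  by rewrite -{1}st (@nth_map Ri 0%R C (RtoC 0)) // szt.
have lt : (last 1%R t != 0)%R.
  rewrite (last_nth 0%R) szt /=.
  by apply/eqP => t0; apply: nz; rewrite -zt t0.
(* A mathcomp polynomial is a coefficient list with nonzero last entry, so the list itself serves
   and its Horner evaluation matches [poly_eval]. *)
set p := Polynomial lt.
have lp : lead_coef p = (t`_n)%R by rewrite lead_coefE /= szt.
have [r pr] := closed_field_poly_normal p.
have szr : size r = n.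
  have : size p = n.+1 by [].
  rewrite pr size_scale ?size_prod_XsubC; first by case.
  by rewrite lp; apply/eqP => t0; apply: nz; rewrite -zt t0.
exists (map to_C r); split; first by rewrite size_map.
move=> x; rewrite -{1}st -{1}(to_CK x) -to_C_horner.
have -> : horner_rec t (of_C x) = (p.[of_C x])%R by [].
rewrite pr hornerZ to_CM lp zt horner_prod -{2}(to_CK x) -to_C_prod.
by congr (Cmult _ (to_C _)); apply: eq_bigr => z _; rewrite hornerXsubC.
Qed.

End FundamentalTheoremOfAlgebra.

Lemma poly_split (p : list C) (n : nat) :
  length p = S n -> nth n p 0 <> 0 ->
  exists r : list C, length r = n /\
    forall x, poly_eval p x = nth n p 0 * root_product r x.
Proof. exact (FundamentalTheoremOfAlgebra.split_poly p n). Qed.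

Lemma P1_locally_Some (w : C) (P : P1 -> Prop) :
  P1_locally (Some w) P <-> locally w (fun z => P (Some z)).
Proof.
  split.
  - intros [H H']. change (locally w (fun z => z <> w -> P (Some z))) in H'.
    revert H'. apply filter_imp. intros z Hz.
    destruct (Ceq_dec z w) as [->|Hzw]; auto.
  - intros H. split; [exact (locally_singleton _ _ H)|].
    change (locally w (fun z => z <> w -> P (Some z))).
    revert H. apply filter_imp. auto.
Qed.

Lemma P1_punctured_and (X : P1) (P Q : C -> Prop) :
  P1_punctured X P -> P1_punctured X Q -> P1_punctured X (fun z => P z /\ Q z).
Proof.
  destruct X as [x|]; simpl.
  - intros HP HQ. exact (filter_and _ _ HP HQ).
  - intros [M HM] [M' HM']. exists (Rmax M M'). intros z Hz.
    split; [apply HM|apply HM']; (eapply Rle_lt_trans; [|exact Hz]);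
      [apply Rmax_l|apply Rmax_r].
Qed.

Lemma P1_punctured_imp (X : P1) (P Q : C -> Prop) :
  (forall z, P z -> Q z) -> P1_punctured X P -> P1_punctured X Q.
Proof.
  destruct X as [x|]; simpl; intros HPQ.
  - intros HP. exact (filter_imp _ _ HPQ HP).
  - intros [M HM]. exists M. auto.
Qed.

Fixpoint poly_eval_derive (p : list C) (x : C) : C :=
  match p with [] => 0 | _ :: p' => poly_eval p' x + x * poly_eval_derive p' x end.

Lemma is_derive_poly_eval (p : list C) (x : C) :
  is_derive (poly_eval p) x (poly_eval_derive p x).
Proof.
  induction p as [|c p IH]; [apply is_derive_C_const|].
  eapply is_derive_C_eq.
  - apply (is_derive_C_plus (fun _ => c) (fun x => x * poly_eval p x)); [apply is_derive_C_const|].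
    apply (is_derive_C_mult (fun x => x)); [apply is_derive_C_id|exact IH].
  - simpl. ring.
Qed.

Lemma poly_eval_locally (p : list C) (x : C) (P : C -> Prop) :
  locally (poly_eval p x) P -> locally x (fun z => P (poly_eval p z)).
Proof. apply (is_derive_C_locally _ _ _ _ (is_derive_poly_eval p x)). Qed.

Lemma root_product_eq_0 (r : list C) (x : C) : root_product r x = 0 <-> In x r.
Proof.
  induction r as [|a r IH]; simpl.
  - split; [apply C1_nz|tauto].
  - rewrite <- IH. split.
    + intros H. destruct (Ceq_dec (x - a) 0) as [E|E].
      * left. symmetry. apply Ceq_minus, E.
      * right. destruct (Ceq_dec (root_product r x) 0) as [E'|E']; [exact E'|].
        exfalso. exact (Cmult_neq_0 _ _ E E' H).
    + intros [-> | ->]; ring.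
Qed.

Lemma root_product_lower_bound (r : list C) (x : C) (e : R) :
  (0 <= e)%R -> (forall a, In a r -> (e <= Cmod (x - a))%R) ->
  (e ^ length r <= Cmod (root_product r x))%R.
Proof.
  intros He H. induction r as [|a r IH]; simpl.
  - rewrite Cmod_1. lra.
  - rewrite Cmod_mult. apply Rmult_le_compat; [exact He|apply pow_le, He| |].
    + apply H. now left.
    + apply IH. intros b Hb. apply H. now right.
Qed.

(** If every root were at distance at least [e] from [x], the factorization would give |p(x)| >=
    |lead| e^n. This elementary bound supplies the continuity of roots. *)
Lemma poly_root_near (p : list C) (n : nat) (x : C) (e : R) :
  length p = S n -> nth n p 0 <> 0 -> (0 < e)%R ->
  (Cmod (poly_eval p x) < Cmod (nth n p 0%C) * e ^ n)%R ->
  exists y, poly_eval p y = 0 /\ (Cmod (y - x) < e)%R.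
Proof.
  intros Hp Hn He H. destruct (poly_split p n Hp Hn) as [r [Hr Hs]].
  apply NNPP. intros Hno.
  apply (Rlt_irrefl (Cmod (poly_eval p x))).
  eapply Rlt_le_trans; [exact H|]. rewrite Hs, Cmod_mult.
  apply Rmult_le_compat_l; [apply Cmod_ge_0|].
  rewrite <- Hr. apply root_product_lower_bound; [lra|].
  intros a Ha. apply Rnot_lt_le. intros Hlt. apply Hno. exists a. split.
  - rewrite Hs, (proj2 (root_product_eq_0 r a) Ha). ring.
  - rewrite <- Cmod_opp. replace (- (a - x)) with (x - a) by ring. exact Hlt.
Qed.

Lemma poly_has_root (p : list C) (n : nat) :
  length p = S (S n) -> nth (S n) p 0 <> 0 -> exists x, poly_eval p x = 0.
Proof.
  intros Hp Hn. destruct (poly_split p (S n) Hp Hn) as [[|a r] [Hr Hs]]; [discriminate|].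
  exists a. rewrite Hs. simpl. ring.
Qed.

(** The n distinct members of [r] all lie in the list of n roots given by the factorization, so by
    counting they exhaust it. *)
Lemma poly_roots_complete (p : list C) (n : nat) (r : list C) :
  length p = S n -> nth n p 0 <> 0 -> NoDup r -> length r = n ->
  (forall x, In x r -> poly_eval p x = 0) ->
  forall x, poly_eval p x = 0 -> In x r.
Proof.
  intros Hp Hn Hd Hr H. destruct (poly_split p n Hp Hn) as [t [Ht Hs]].
  assert (Hroot : forall x, poly_eval p x = 0 -> In x t).
  { intros x Hx. apply root_product_eq_0. rewrite Hs in Hx.
    destruct (Ceq_dec (root_product t x) 0) as [E|E]; [exact E|].
    exfalso. exact (Cmult_neq_0 _ _ Hn E Hx). }
  intros x Hx. assert (I : incl t r).
  { apply NoDup_length_incl; [exact Hd|lia|]. intros y Hy. apply Hroot, H, Hy. }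
  apply I, Hroot, Hx.
Qed.

Lemma root_product_double (r : list C) (i j : nat) :
  (i < j < length r)%nat -> nth i r 0 = nth j r 0 ->
  exists g : list C, forall x, root_product r x = (x - nth i r 0) ^ 2 * root_product g x.
Proof.
  revert i j. induction r as [|a r IH]; intros i j Hij E; [simpl in Hij; lia|].
  destruct j as [|j]; [lia|]. destruct i as [|i]; simpl in *.
  - assert (Ha : In a r) by (rewrite E; apply nth_In; lia).
    apply in_split in Ha as [r1 [r2 ->]]. exists (r1 ++ r2). intros x.
    assert (App : forall s t, root_product (s ++ t) x = root_product s x * root_product t x).
    { intros s t. induction s as [|b s IHs]; simpl; [ring|rewrite IHs; ring]. }
    rewrite !App. simpl. ring.
  - destruct (IH i j ltac:(lia) E) as [g Hg]. exists (a :: g). intros x.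
    rewrite Hg. simpl. ring.
Qed.

(** A repetition in [r] produces a factor (x - a)^2, which makes the derivative vanish at the root
    a. *)
Lemma poly_simple_roots_NoDup (p : list C) (n : nat) (r : list C) :
  length r = n -> (forall x, poly_eval p x = nth n p 0 * root_product r x) ->
  (forall x, poly_eval p x = 0 -> poly_eval_derive p x <> 0) -> NoDup r.
Proof.
  intros Hr Hs Hd. apply (NoDup_nth r 0).
  assert (L : forall i j, (i < j < length r)%nat -> nth i r 0 <> nth j r 0).
  { intros i j Hij E. destruct (root_product_double r i j Hij E) as [g Hg].
    set (a := nth i r 0) in *.
    apply (Hd a).
    - rewrite Hs, Hg. replace (a - a) with (RtoC 0) by ring. ring.
    - apply (is_derive_C_unique (poly_eval p) a); [apply is_derive_poly_eval|].
      assert (Dg : exists l : C, is_derive (root_product g) a l).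
      { clear. induction g as [|b g [l Hl]]; [exists (RtoC 0); apply is_derive_C_const|].
        eexists. apply (is_derive_C_mult (fun x => x - b)); [|exact Hl].
        apply is_derive_C_minus; [apply is_derive_C_id|apply is_derive_C_const]. }
      destruct Dg as [l Hl].
      apply (is_derive_C_ext_loc (fun x => nth n p 0 * ((x - a) ^ 2 * root_product g x))).
      + apply filter_forall. intros x. rewrite Hs, Hg. reflexivity.
      + eapply is_derive_C_eq.
        * apply is_derive_C_scal.
          apply (is_derive_C_mult (fun x => (x - a) ^ 2)); [|exact Hl].
          apply (is_derive_C_pow (fun x => x - a)).
          apply is_derive_C_minus; [apply is_derive_C_id|apply is_derive_C_const].
        * cbv beta. replace (a - a) with (RtoC 0) by ring. simpl Cpow. ring. }
  intros i j Hi Hj E. destruct (Nat.lt_total i j) as [H|[H|H]]; [|exact H|].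
  - exfalso. apply (L i j); [lia|exact E].
  - exfalso. apply (L j i); [lia|auto].
Qed.

Lemma NoDup_separated (r : list C) :
  NoDup r -> exists e, (0 < e)%R /\
    forall a b x, In a r -> In b r ->
      (Cmod (x - a) < e)%R -> (Cmod (x - b) < e)%R -> a = b.
Proof.
  induction 1 as [|a r Ha Hr [e [He IH]]].
  - exists 1%R. split; [lra|]. intros a b x [].
  - assert (Hf : exists f, (0 < f)%R /\ forall b, In b r -> (2 * f <= Cmod (a - b))%R).
    { clear - Ha. induction r as [|b r IHr].
      - exists 1%R. split; [lra|]. intros b [].
      - destruct IHr as [f [Hf Hb]]; [simpl in Ha; tauto|].
        assert (Hab : (0 < Cmod (a - b))%R).
        { apply Cmod_gt_0. intros E. apply Ha. left. symmetry. apply Ceq_minus, E. }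
        exists (Rmin f (Cmod (a - b) / 2)). split; [apply Rmin_pos; lra|].
        intros b' [<-|Hb'].
        + generalize (Rmin_r f (Cmod (a - b) / 2)). lra.
        + specialize (Hb b' Hb'). generalize (Rmin_l f (Cmod (a - b) / 2)). lra. }
    destruct Hf as [f [Hf Hb]]. exists (Rmin e f). split; [apply Rmin_pos; assumption|].
    assert (Hef := Rmin_l e f). assert (Hff := Rmin_r e f).
    assert (T : forall b x, In b r -> (Cmod (x - a) < Rmin e f)%R ->
      (Cmod (x - b) < Rmin e f)%R -> False).
    { intros b x Hbr H1 H2. specialize (Hb b Hbr).
      assert (T := Cmod_triangle (a - x) (x - b)).
      replace (a - x + (x - b)) with (a - b) in T by ring.
      rewrite <- (Cmod_opp (a - x)) in T. replace (- (a - x)) with (x - a) in T by ring. lra. }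
    intros u v x [<-|Hu] [<-|Hv] H1 H2.
    + reflexivity.
    + exfalso. eapply T; eauto.
    + exfalso. eapply T; eauto.
    + apply (IH u v x); auto; lra.
Qed.

(** The terms below the leading one are O(|z|^(n-1)); the bound is multiplied by |z| so that n = 0
    fits. *)
Lemma poly_growth (p : list C) (n : nat) :
  length p = S n ->
  exists K, (0 <= K)%R /\ forall z, (1 <= Cmod z)%R ->
    (Cmod (poly_eval p z - nth n p 0%C * z ^ n) * Cmod z <= K * Cmod z ^ n)%R.
Proof.
  revert n. induction p as [|c p IH]; intros n Hn; [discriminate|].
  destruct n as [|n].
  - destruct p; [|discriminate]. exists 0%R. split; [lra|]. intros z Hz.
    simpl. replace (c + z * 0 - c * 1) with (RtoC 0) by ring. rewrite Cmod_0. lra.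
  - destruct (IH n ltac:(simpl in Hn; lia)) as [K [HK H]].
    exists (Cmod c + K)%R. split; [generalize (Cmod_ge_0 c); lra|]. intros z Hz.
    simpl nth. simpl poly_eval.
    replace (c + z * poly_eval p z - nth n p 0 * z ^ S n)
      with (c + z * (poly_eval p z - nth n p 0 * z ^ n)) by (simpl; ring).
    apply Rle_trans with
      ((Cmod c + Cmod z * Cmod (poly_eval p z - nth n p 0%C * z ^ n)) * Cmod z)%R.
    + apply Rmult_le_compat_r; [apply Cmod_ge_0|].
      rewrite <- Cmod_mult. apply Cmod_triangle.
    + specialize (H z Hz). simpl pow.
      set (d := Cmod (poly_eval p z - nth n p 0 * z ^ n)) in *.
      set (t := Cmod z) in *. assert (Hc := Cmod_ge_0 c).
      assert (1 <= t ^ n)%R by (apply pow_R1_Rle; exact Hz).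
      replace ((Cmod c + t * d) * t)%R with (Cmod c * t + t * (d * t))%R by ring.
      replace ((Cmod c + K) * (t * t ^ n))%R
        with (Cmod c * (t * t ^ n) + t * (K * t ^ n))%R by ring.
      apply Rplus_le_compat.
      * apply Rmult_le_compat_l; [exact Hc|]. nra.
      * apply Rmult_le_compat_l; [lra|exact H].
Qed.

(** * Rational self-maps of the projective line; the finite fibre over w consists of the roots of N
    - w D *)

Definition poly_minus_scal (N D : list C) (w : C) : list C :=
  map (fun nd => fst nd - w * snd nd) (combine N D).

Lemma poly_minus_scal_length (N D : list C) (w : C) :
  length N = length D -> length (poly_minus_scal N D w) = length N.
Proof.
  intros H. unfold poly_minus_scal. rewrite length_map, length_combine, <- H.
  apply Nat.min_id.
Qed.

Lemma poly_minus_scal_nth (N D : list C) (w : C) (i : nat) :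
  length N = length D -> nth i (poly_minus_scal N D w) 0 = nth i N 0 - w * nth i D 0.
Proof.
  unfold poly_minus_scal. revert D i.
  induction N as [|c N IH]; intros [|d D] [|i] H; simpl; try discriminate; try ring.
  apply IH. now injection H.
Qed.

Lemma poly_minus_scal_eval (N D : list C) (w x : C) :
  length N = length D ->
  poly_eval (poly_minus_scal N D w) x = poly_eval N x - w * poly_eval D x.
Proof.
  unfold poly_minus_scal. revert D.
  induction N as [|c N IH]; intros [|d D] H; simpl; try discriminate; try ring.
  rewrite IH by (now injection H). ring.
Qed.

Lemma locally_Forall_lt (w : C) (P : nat -> C -> Prop) (k : nat) :
  (forall i, (i < k)%nat -> locally w (P i)) ->
  locally w (fun v => forall i, (i < k)%nat -> P i v).
Proof.
  induction k as [|k IH]; intros H.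
  - apply filter_forall. intros v i Hi. lia.
  - assert (Hlt : locally w (fun v => forall i, (i < k)%nat -> P i v)) by (apply IH; auto with arith).
    assert (Hk : locally w (P k)) by (apply H; lia).
    generalize (filter_and _ _ Hlt Hk). apply filter_imp. intros v [H1 H2] i Hi.
    destruct (Nat.eq_dec i k) as [->|Hik]; [exact H2|apply H1; lia].
Qed.

(* [n] is meant to be the degree of [D] and at least that of [N]. *)
Definition rational_map (N D : list C) (n : nat) (X : P1) : P1 :=
  match X with
  | None => Some (nth n N 0 / nth n D 0)
  | Some x => if Ceq_dec (poly_eval D x) 0 then None
              else Some (poly_eval N x / poly_eval D x)
  end.

Section RationalMap.

Variables (N D : list C) (n : nat).
Hypothesis (HN : length N = S (S n)) (HD : length D = S (S n)).
Hypothesis HDn : nth (S n) D 0 <> 0.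
Hypothesis Hcop : forall x, poly_eval D x = 0 -> poly_eval N x <> 0.

Local Notation Phi := (rational_map N D (S n)).
Local Notation top := (nth (S n) N 0 / nth (S n) D 0).

Lemma rational_map_Some (x w : C) :
  Phi (Some x) = Some w <-> poly_eval N x - w * poly_eval D x = 0.
Proof.
  simpl. destruct (Ceq_dec (poly_eval D x) 0) as [E|E]; split.
  - discriminate.
  - intros H. exfalso. apply (Hcop x E). rewrite E in H. rewrite <- H. ring.
  - intros [= <-]. field. exact E.
  - intros H. f_equal. replace (poly_eval N x) with (w * poly_eval D x).
    + field. exact E.
    + symmetry. apply Ceq_minus, H.
Qed.

Lemma rational_map_None (x : C) : Phi (Some x) = None <-> poly_eval D x = 0.
Proof. simpl. destruct (Ceq_dec (poly_eval D x) 0); split; try tauto; discriminate. Qed.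

Lemma denominator_punctured (X : P1) : P1_punctured X (fun z => poly_eval D z <> 0).
Proof.
  destruct (poly_split D (S n) HD HDn) as [r [_ Hs]].
  assert (H : forall z, ~ In z r -> poly_eval D z <> 0).
  { intros z Hz. rewrite Hs. apply Cmult_neq_0; [exact HDn|].
    intros E. apply Hz, root_product_eq_0, E. }
  apply (P1_punctured_imp _ _ _ H). clear.
  induction r as [|a r IH].
  - destruct X; simpl; [apply filter_forall; auto|exists 0%R; auto].
  - assert (Ha : P1_punctured X (fun z => z <> a)).
    { destruct X as [x|]; simpl.
      - destruct (Ceq_dec x a) as [->|E].
        + change (locally a (fun z => z <> a -> z <> a)). apply filter_forall. auto.
        + change (locally x (fun z => z <> x -> z <> a)).
          generalize (locally_neq _ _ E). apply filter_imp. auto.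
      - exists (Cmod a). intros z Hz ->. lra. }
    generalize (P1_punctured_and _ _ _ IH Ha). apply P1_punctured_imp.
    intros z [H1 H2] [E|E]; auto.
Qed.

Lemma rational_map_at_infinity (e : R) : (0 < e)%R ->
  exists M : R, forall z, (M < Cmod z)%R ->
    poly_eval D z <> 0 /\ (Cmod (poly_eval N z / poly_eval D z - top) < e)%R.
Proof.
  intros He.
  (* Subtracting the limit value kills the leading coefficient, so [F] has lower order than [D] at
     infinity. *)
  set (F := poly_minus_scal N D top).
  assert (HNF : length N = length D) by congruence.
  assert (HF : length F = S (S n)) by (unfold F; rewrite poly_minus_scal_length; congruence).
  destruct (poly_growth F (S n) HF) as [K1 [HK1 H1]].
  destruct (poly_growth D (S n) HD) as [K2 [HK2 H2]].
  set (d := nth (S n) D 0) in *.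
  assert (Hd : (0 < Cmod d)%R) by (apply Cmod_gt_0; exact HDn).
  assert (F0 : nth (S n) F 0 = 0).
  { unfold F. rewrite poly_minus_scal_nth by exact HNF. unfold d. field. exact HDn. }
  (* The second bound keeps |D(z)| above half of its leading term; the third then makes |F(z)| /
     |D(z)| smaller than [e]. *)
  exists (Rmax 1 (Rmax (2 * K2 / Cmod d) (2 * K1 / Cmod d / e))).
  intros z Hz.
  assert (Z1 : (1 < Cmod z)%R) by (eapply Rle_lt_trans; [apply Rmax_l|exact Hz]).
  assert (Z2 : (2 * K2 / Cmod d < Cmod z)%R).
  { eapply Rle_lt_trans; [|exact Hz]. eapply Rle_trans; [apply Rmax_l|apply Rmax_r]. }
  assert (Z3 : (2 * K1 / Cmod d / e < Cmod z)%R).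
  { eapply Rle_lt_trans; [|exact Hz]. eapply Rle_trans; [apply Rmax_r|apply Rmax_r]. }
  specialize (H1 z ltac:(lra)). specialize (H2 z ltac:(lra)).
  rewrite F0 in H1. replace (poly_eval F z - 0 * z ^ S n) with (poly_eval F z) in H1 by ring.
  unfold F in H1. rewrite poly_minus_scal_eval in H1 by exact HNF.
  set (t := Cmod z) in *. set (T := (t ^ S n)%R) in *.
  assert (HT : (0 < T)%R) by (apply pow_lt; lra).
  assert (G2 : (Cmod (poly_eval D z - d * z ^ S n) < Cmod d / 2 * T)%R).
  { apply Rmult_lt_reg_r with t; [lra|]. eapply Rle_lt_trans; [exact H2|].
    replace (Cmod d / 2 * T * t)%R with (Cmod d / 2 * t * T)%R by ring.
    apply Rmult_lt_compat_r; [exact HT|].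
    apply Rmult_lt_compat_r with (r := (Cmod d / 2)%R) in Z2; [|lra].
    replace (2 * K2 / Cmod d * (Cmod d / 2))%R with K2 in Z2 by (field; lra). lra. }
  assert (G3 : (Cmod d / 2 * T <= Cmod (poly_eval D z))%R).
  { assert (T3 := Cmod_triangle (poly_eval D z) (- (poly_eval D z - d * z ^ S n))).
    replace (poly_eval D z + - (poly_eval D z - d * z ^ S n)) with (d * z ^ S n) in T3 by ring.
    rewrite Cmod_opp, Cmod_mult, Cmod_pow in T3. fold t in T3. fold T in T3. lra. }
  assert (G4 : (0 < Cmod d / 2 * T)%R) by (apply Rmult_lt_0_compat; lra).
  assert (Dz : poly_eval D z <> 0) by (apply Cmod_gt_0; lra).
  split; [exact Dz|].
  set (q := nth (S n) N 0 / d) in *.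
  replace (poly_eval N z / poly_eval D z - q)
    with ((poly_eval N z - q * poly_eval D z) / poly_eval D z) by (field; assumption).
  rewrite Cmod_div by exact Dz.
  set (A := Cmod (poly_eval N z - q * poly_eval D z)) in *.
  apply Rmult_lt_reg_r with (Cmod (poly_eval D z)); [lra|].
  replace (A / Cmod (poly_eval D z) * Cmod (poly_eval D z))%R with A by (field; lra).
  apply Rlt_le_trans with (e * (Cmod d / 2 * T))%R; [|apply Rmult_le_compat_l; lra].
  apply Rmult_lt_reg_r with t; [lra|]. eapply Rle_lt_trans; [exact H1|].
  replace (e * (Cmod d / 2 * T) * t)%R with (e * (Cmod d / 2) * t * T)%R by ring.
  apply Rmult_lt_compat_r; [exact HT|].
  apply Rmult_lt_compat_r with (r := (e * (Cmod d / 2))%R) in Z3;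
    [|apply Rmult_lt_0_compat; lra].
  replace (2 * K1 / Cmod d / e * (e * (Cmod d / 2)))%R with K1 in Z3 by (field; lra). lra.
Qed.

Lemma rational_map_continuous (X : P1) : P1_continuous_at Phi X.
Proof.
  intros P HP. unfold filtermap.
  destruct X as [x|].
  - apply P1_locally_Some.
    destruct (Ceq_dec (poly_eval D x) 0) as [E|E].
    (* At a pole coprimality keeps N away from 0 while D tends to 0, so the quotient exceeds any
       M. *)
    + rewrite (proj2 (rational_map_None x) E) in HP. destruct HP as [HP0 [M HM]].
      assert (HNx : (0 < Cmod (poly_eval N x))%R) by (apply Cmod_gt_0, Hcop, E).
      set (a := Cmod (poly_eval N x)) in *.
      assert (L1 : locally x (fun z => (a / 2 < Cmod (poly_eval N z))%R)).
      { apply (poly_eval_locally N x (fun w => (a / 2 < Cmod w)%R)).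
        apply locally_Cmod. exists (a / 2)%R. split; [lra|]. intros w Hw.
        assert (T := Cmod_triangle w (- (w - poly_eval N x))).
        replace (w + - (w - poly_eval N x)) with (poly_eval N x) in T by ring.
        rewrite Cmod_opp in T. fold a in T. lra. }
      assert (L2 : locally x (fun z => (Cmod (poly_eval D z) < a / 2 / (Rabs M + 1))%R)).
      { apply (poly_eval_locally D x (fun w => (Cmod w < a / 2 / (Rabs M + 1))%R)).
        rewrite E. apply locally_Cmod. exists (a / 2 / (Rabs M + 1))%R.
        split; [apply Rdiv_lt_0_compat; [lra|generalize (Rabs_pos M); lra]|].
        intros w Hw. replace (w - 0) with w in Hw by ring. exact Hw. }
      generalize (filter_and _ _ L1 L2). apply filter_imp. intros z [Z1 Z2].
      simpl. destruct (Ceq_dec (poly_eval D z) 0) as [Ez|Ez]; [exact HP0|].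
      apply HM. rewrite Cmod_div by exact Ez.
      assert (Dz : (0 < Cmod (poly_eval D z))%R) by (apply Cmod_gt_0, Ez).
      assert (M0 := Rabs_pos M). assert (M1 := Rle_abs M).
      apply Rmult_lt_reg_r with (Cmod (poly_eval D z)); [exact Dz|].
      replace (Cmod (poly_eval N z) / Cmod (poly_eval D z) * Cmod (poly_eval D z))%R
        with (Cmod (poly_eval N z)) by (field; lra).
      apply Rmult_lt_compat_l with (r := (Rabs M + 1)%R) in Z2; [|lra].
      replace ((Rabs M + 1) * (a / 2 / (Rabs M + 1)))%R with (a / 2)%R in Z2 by (field; lra).
      nra.
    + simpl in HP. destruct (Ceq_dec (poly_eval D x) 0) as [E'|_]; [contradiction|].
      apply P1_locally_Some in HP.
      assert (L1 : locally x (fun z => poly_eval D z <> 0)).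
      { apply (poly_eval_locally D x (fun w => w <> 0)), locally_neq, E. }
      assert (L2 : locally x (fun z => P (Some (poly_eval N z * / poly_eval D z)))).
      { refine (is_derive_C_locally (fun z => poly_eval N z * / poly_eval D z) x _ _ _ HP).
        apply (is_derive_C_mult (poly_eval N) (fun z => / poly_eval D z)).
        - apply is_derive_poly_eval.
        - apply is_derive_C_inv; [apply is_derive_poly_eval|exact E]. }
      generalize (filter_and _ _ L1 L2). apply filter_imp. intros z [Z1 Z2].
      simpl. destruct (Ceq_dec (poly_eval D z) 0) as [E'|_]; [contradiction|exact Z2].
  - split; [exact (proj1 HP)|].
    change (P1_locally (Some top) P) in HP.
    apply P1_locally_Some, locally_Cmod in HP as [e [He HP]].
    destruct (rational_map_at_infinity e He) as [M HM]. exists M. intros z Hz.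
    destruct (HM z Hz) as [H1 H2]. simpl.
    destruct (Ceq_dec (poly_eval D z) 0) as [E'|_]; [contradiction|]. apply HP, H2.
Qed.

Lemma rational_map_extension (f : C -> C) :
  (forall x, poly_eval D x <> 0 -> f x = poly_eval N x / poly_eval D x) ->
  P1_extension f Phi.
Proof.
  intros Hf X P HP. assert (T := proj2 (rational_map_continuous X P HP)). unfold filtermap.
  generalize (P1_punctured_and _ _ _ T (denominator_punctured X)). apply P1_punctured_imp.
  intros z [H1 H2]. rewrite (Hf z H2). simpl in H1.
  destruct (Ceq_dec (poly_eval D z) 0) as [E'|_]; [contradiction|exact H1].
Qed.

Lemma fibre_lead_neq_0 (w : C) : w <> top -> nth (S n) (poly_minus_scal N D w) 0 <> 0.
Proof.
  intros Hw E. rewrite poly_minus_scal_nth in E by congruence. apply Hw.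
  apply Ceq_minus in E. rewrite E. field. exact HDn.
Qed.

Lemma rational_map_surjective (W : P1) : exists X, Phi X = W.
Proof.
  destruct W as [w|].
  - destruct (Ceq_dec w top) as [->|Hw]; [exists None; reflexivity|].
    destruct (poly_has_root (poly_minus_scal N D w) n) as [x Hx].
    + rewrite poly_minus_scal_length; congruence.
    + apply fibre_lead_neq_0, Hw.
    + exists (Some x). apply rational_map_Some.
      rewrite <- Hx. symmetry. apply poly_minus_scal_eval. congruence.
  - destruct (poly_has_root D n HD HDn) as [x Hx].
    exists (Some x). apply rational_map_None, Hx.
Qed.

(** At [x] the polynomial N - v D takes the value (w - v) D(x), small for v near w, while its
    leading coefficient stays away from 0 because w differs from [top]; then [poly_root_near]
    applies. *)
Lemma fibre_root_near (w x : C) (e : R) : w <> top -> (0 < e)%R ->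
  poly_eval N x - w * poly_eval D x = 0 ->
  locally w (fun v => exists y, poly_eval N y - v * poly_eval D y = 0 /\ (Cmod (y - x) < e)%R).
Proof.
  intros Hw He Hx.
  set (c := nth (S n) D 0) in *.
  set (a := Cmod (nth (S n) N 0 - w * c)).
  assert (Ha : (0 < a)%R).
  { apply Cmod_gt_0. unfold c. rewrite <- poly_minus_scal_nth by congruence.
    apply fibre_lead_neq_0, Hw. }
  assert (Hc := Cmod_ge_0 c). assert (Hdx := Cmod_ge_0 (poly_eval D x)).
  set (ee := (e ^ S n)%R). assert (Hee : (0 < ee)%R) by (apply pow_lt, He).
  assert (L1 : locally w (fun v => (Cmod (v - w) < a / 2 / (Cmod c + 1))%R)).
  { apply locally_Cmod. exists (a / 2 / (Cmod c + 1))%R.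
    split; [apply Rdiv_lt_0_compat; lra|auto]. }
  assert (L2 : locally w (fun v => (Cmod (v - w) < a / 2 * ee / (Cmod (poly_eval D x) + 1))%R)).
  { apply locally_Cmod. exists (a / 2 * ee / (Cmod (poly_eval D x) + 1))%R.
    split; [apply Rdiv_lt_0_compat; [apply Rmult_lt_0_compat|]; lra|auto]. }
  generalize (filter_and _ _ L1 L2). apply filter_imp. intros v [V1 V2].
  assert (Hlead : (a / 2 < Cmod (nth (S n) (poly_minus_scal N D v) 0%C))%R).
  { rewrite poly_minus_scal_nth by congruence. fold c.
    assert (T := Cmod_triangle (nth (S n) N 0 - v * c) ((v - w) * c)).
    replace (nth (S n) N 0 - v * c + (v - w) * c) with (nth (S n) N 0 - w * c) in T by ring.
    fold a in T. rewrite Cmod_mult in T.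
    apply Rmult_lt_compat_r with (r := (Cmod c + 1)%R) in V1; [|lra].
    replace (a / 2 / (Cmod c + 1) * (Cmod c + 1))%R with (a / 2)%R in V1 by (field; lra).
    generalize (Cmod_ge_0 (v - w)). lra. }
  destruct (poly_root_near (poly_minus_scal N D v) (S n) x e) as [y [Hy1 Hy2]].
  - rewrite poly_minus_scal_length; congruence.
  - intros E. rewrite E, Cmod_0 in Hlead. lra.
  - exact He.
  - rewrite poly_minus_scal_eval by congruence.
    replace (poly_eval N x - v * poly_eval D x) with
      ((poly_eval N x - w * poly_eval D x) - (v - w) * poly_eval D x) by ring.
    rewrite Hx. replace (0 - (v - w) * poly_eval D x) with (- ((v - w) * poly_eval D x)) by ring.
    rewrite Cmod_opp, Cmod_mult. fold ee.
    apply Rmult_lt_compat_r with (r := (Cmod (poly_eval D x) + 1)%R) in V2; [|lra].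
    replace (a / 2 * ee / (Cmod (poly_eval D x) + 1) * (Cmod (poly_eval D x) + 1))%R
      with (a / 2 * ee)%R in V2 by (field; lra).
    generalize (Cmod_ge_0 (v - w)). nra.
  - exists y. split; [|exact Hy2]. rewrite <- Hy1. symmetry.
    apply poly_minus_scal_eval. congruence.
Qed.

Lemma rational_map_evenly_covered (w0 : C) :
  w0 <> top ->
  (forall x, Phi (Some x) = Some w0 ->
     poly_eval_derive N x - w0 * poly_eval_derive D x <> 0) ->
  evenly_covered Phi (S n) (Some w0).
Proof.
  intros Hw0 Hreg.
  assert (HND : length N = length D) by congruence.
  assert (Hlen : forall w, length (poly_minus_scal N D w) = S (S n))
    by (intros w; rewrite poly_minus_scal_length; congruence).
  assert (Hev : forall w x, poly_eval (poly_minus_scal N D w) x = poly_eval N x - w * poly_eval D x)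
    by (intros; apply poly_minus_scal_eval, HND).
  destruct (poly_split _ _ (Hlen w0) (fibre_lead_neq_0 w0 Hw0)) as [r [Hr Hs]].
  assert (Hd : NoDup r).
  { apply (poly_simple_roots_NoDup _ _ r Hr Hs). intros x Hx E.
    rewrite Hev in Hx. apply (Hreg x); [apply rational_map_Some, Hx|].
    rewrite <- E.
    apply (is_derive_C_unique (fun z => poly_eval N z - w0 * poly_eval D z) x).
    - apply is_derive_C_minus; [|apply is_derive_C_scal]; apply is_derive_poly_eval.
    - apply (is_derive_C_ext_loc (poly_eval (poly_minus_scal N D w0))).
      + apply filter_forall. apply Hev.
      + apply is_derive_poly_eval. }
  destruct (NoDup_separated r Hd) as [e [He Hsep]].
  set (c := fun i => nth i r 0).
  assert (Hc : forall i, (i < S n)%nat -> In (c i) r) by (intros i Hi; apply nth_In; lia).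
  set (disc := fun (i : nat) (w x : C) =>
    poly_eval N x - w * poly_eval D x = 0 /\ (Cmod (x - c i) < e)%R).
  (* The i-th sheet: a root chosen in the i-th of the disjoint discs around the roots over [w0]. *)
  set (g := fun (i : nat) (w : C) => epsilon (inhabits (RtoC 0)) (disc i w)).
  set (U := fun w : C => w <> top /\ forall i, (i < S n)%nat -> exists x, disc i w x).
  assert (LU : locally w0 U).
  { apply filter_and; [apply locally_neq, Hw0|]. apply locally_Forall_lt. intros i Hi.
    apply (fibre_root_near w0 (c i) e Hw0 He).
    rewrite <- Hev, Hs. rewrite (proj2 (root_product_eq_0 r (c i)) (Hc i Hi)). ring. }
  assert (Hg : forall i w, (i < S n)%nat -> U w -> disc i w (g i w)).
  { intros i w Hi [_ Hw]. apply epsilon_spec, Hw, Hi. }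
  assert (Hinj : forall i j w x, (i < S n)%nat -> (j < S n)%nat ->
            disc i w x -> disc j w x -> i = j).
  { intros i j w x Hi Hj [_ H1] [_ H2].
    apply (proj1 (NoDup_nth r 0) Hd); try lia.
    exact (Hsep _ _ x (Hc i Hi) (Hc j Hj) H1 H2). }
  (* The chosen roots lie in disjoint discs, hence are distinct, and their number equals the degree
     of N - w D: there are no others. *)
  assert (Hall : forall w x, U w -> poly_eval N x - w * poly_eval D x = 0 ->
            exists i, (i < S n)%nat /\ x = g i w).
  { intros w x Hw Hx.
    assert (T := poly_roots_complete (poly_minus_scal N D w) (S n)
                   (map (fun i => g i w) (seq 0 (S n))) (Hlen w)
                   (fibre_lead_neq_0 w (proj1 Hw))).
    assert (Hin : In x (map (fun i => g i w) (seq 0 (S n)))).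
    { apply T.
      - apply NoDup_map_NoDup_ForallPairs; [|apply seq_NoDup].
        intros i j Hi Hj E. apply in_seq in Hi, Hj.
        apply (Hinj i j w (g i w)); try lia; [apply Hg; [lia|exact Hw]|].
        rewrite E. apply Hg; [lia|exact Hw].
      - rewrite length_map, length_seq. reflexivity.
      - intros y Hy. apply in_map_iff in Hy as [i [<- Hi]]. apply in_seq in Hi.
        rewrite Hev. apply Hg; [lia|exact Hw].
      - rewrite Hev. exact Hx. }
    apply in_map_iff in Hin as [i [E Hi]]. apply in_seq in Hi.
    exists i. split; [lia|auto]. }
  (* Each disc therefore contains exactly one root, so the arbitrary choice is a function determined
     by the disc, and its continuity can be proved. *)
  assert (Huniq : forall i w x, (i < S n)%nat -> U w -> disc i w x -> x = g i w).
  { intros i w x Hi Hw Hx. destruct (Hall w x Hw (proj1 Hx)) as [j [Hj Ej]].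
    assert (E : i = j).
    { apply (Hinj i j w x Hi Hj Hx). rewrite Ej. apply Hg; assumption. }
    rewrite E. exact Ej. }
  exists (fun i V => match V with Some w => Some (g i w) | None => None end).
  apply P1_locally_Some. apply locally_locally in LU. revert LU. apply filter_imp.
  intros w LU. assert (Uw := locally_singleton _ _ LU). split; [|split].
  - intros i Hi P HP. unfold filtermap. apply P1_locally_Some.
    apply P1_locally_Some, locally_Cmod in HP as [d [Hd0 HP]].
    destruct (Hg i w Hi Uw) as [G1 G2].
    (* Small enough for a root within [f] of [g i w] to remain in the i-th disc, where it must be
       [g i v]. *)
    set (f := Rmin d (e - Cmod (g i w - c i))).
    assert (Hf : (0 < f)%R) by (apply Rmin_pos; lra).
    generalize (filter_and _ _ LU (fibre_root_near w (g i w) f (proj1 Uw) Hf G1)).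
    apply filter_imp. intros v [Uv [y [Y1 Y2]]].
    assert (Y3 : (Cmod (y - g i w) < d)%R) by (eapply Rlt_le_trans; [exact Y2|apply Rmin_l]).
    assert (Y4 : (Cmod (y - g i w) < e - Cmod (g i w - c i))%R)
      by (eapply Rlt_le_trans; [exact Y2|apply Rmin_r]).
    rewrite <- (Huniq i v y Hi Uv); [apply HP, Y3|].
    split; [exact Y1|].
    replace (y - c i) with ((y - g i w) + (g i w - c i)) by ring.
    eapply Rle_lt_trans; [apply Cmod_triangle|lra].
  - intros i j Hi Hj [= E]. apply (Hinj i j w (g i w) Hi Hj); [apply Hg; assumption|].
    rewrite E. apply Hg; assumption.
  - intros [x|]; split.
    + intros H. apply rational_map_Some in H.
      destruct (Hall w x Uw H) as [i [Hi E]]. exists i. split; [exact Hi|now rewrite E].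
    + intros [i [Hi [= ->]]]. apply rational_map_Some, Hg; assumption.
    (* Infinity is sent to [top], a value excluded by [U]. *)
    + intros [= E]. exfalso. apply (proj1 Uw). now rewrite <- E.
    + intros [i [_ E]]. discriminate.
Qed.

(** Placing infinity and the image of infinity in [B] leaves only finite values with finite
    preimages, which are governed by the polynomials N - w D. *)
Lemma rational_map_covering (B : list P1) :
  In None B -> In (Some top) B ->
  (forall x w, Phi (Some x) = Some w ->
     poly_eval_derive N x - w * poly_eval_derive D x = 0 -> In (Some w) B) ->
  covering_of_degree Phi (S n).
Proof.
  intros HBinf HBtop HB. split; [exact rational_map_continuous|].
  split; [exact rational_map_surjective|].
  exists B. intros [w|] HW; [|contradiction].
  apply rational_map_evenly_covered.
  - intros ->. contradiction.
  - intros x Hx E. exact (HW (HB x w Hx E)).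
Qed.

End RationalMap.

(** * The covering phi2 *)

(* Expanded numerator and denominator of phi2, reduced modulo xi^2 + xi + 2. *)
Definition phi2_num (xi : C) : list C :=
  [RtoC 0;
   - 441304644123 - 399780968769 * xi;
   7461239412312 + 2947876541064 * xi;
   - 38619899806068 - 535345774236 * xi;
   78673859979624 - 45142483191624 * xi;
   - 32087170606050 + 149714706722490 * xi;
   - 114768563767704 - 208609101287496 * xi;
   180877941142668 + 136032170611428 * xi;
   - 99408124677582 - 34008042652857 * xi;
   RtoC 18312022966923].
Definition phi2_den (xi : C) : list C :=
  [342559931 - 1240878303 * xi;
   - 179931523443 - 153112291017 * xi;
   - 9234628133556 - 442212943452 * xi;
   - 14390633206236 + 80700088705964 * xi;
   321671157133578 - 163259544796866 * xi;
   - 785175546476874 - 64928065883646 * xi;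
   702318211588700 + 375675132655060 * xi;
   - 188850522570444 - 303456380594724 * xi;
   - 44472055776813 + 75864095148681 * xi;
   RtoC 18312022966923].

Lemma phi2_num_eval (xi x : C) : xi ^ 2 = - xi - 2 ->
  poly_eval (phi2_num xi) x = 49 * numer xi x.
Proof. intros H. unfold numer, linear_factor. simpl poly_eval. field [H]. Qed.

Lemma phi2_den_eval (xi x : C) : xi ^ 2 = - xi - 2 ->
  poly_eval (phi2_den xi) x = 49 * cubic xi x ^ 3.
Proof. intros H. unfold cubic. simpl poly_eval. field [H]. Qed.

Lemma IZR_C_neq_0 (z : Z) : z <> 0%Z -> RtoC (IZR z) <> 0.
Proof. intros Hz E. apply RtoC_inj in E. apply eq_IZR in E. contradiction. Qed.

(* a^2 - ab + 2b^2 is the norm of a + b xi. *)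
Lemma quadratic_neq_0 (xi : C) (a b : Z) : xi ^ 2 = - xi - 2 ->
  (a * a - a * b + 2 * b * b <> 0)%Z -> RtoC (IZR a) + RtoC (IZR b) * xi <> 0.
Proof.
  intros H Hn E. apply (IZR_C_neq_0 _ Hn).
  rewrite plus_IZR, minus_IZR, !mult_IZR, RtoC_plus, RtoC_minus, !RtoC_mult.
  (* The second factor is the Galois conjugate: the other root of the quadratic is -1 - xi. *)
  transitivity ((RtoC (IZR a) + RtoC (IZR b) * xi) * (RtoC (IZR a) - RtoC (IZR b) - RtoC (IZR b) * xi)).
  - ring [H].
  - rewrite E. ring.
Qed.

Lemma phi2_fraction (xi x : C) :
  cubic xi x <> 0 -> phi2 xi x = numer xi x / cubic xi x ^ 3.
Proof.
  intros H. unfold phi2. fold (linear_factor xi x).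
  change (7203 * x ^ 3 + (9947 * xi - 5831) * x ^ 2 - (9947 * xi + 2009) * x + 275 - 87 * xi)
    with (cubic xi x).
  unfold numer. field. exact H.
Qed.

Lemma cubic_numer_coprime (xi x : C) : xi ^ 2 = - xi - 2 ->
  cubic xi x = 0 -> numer xi x <> 0.
Proof.
  intros H Hp HN. unfold numer in HN.
  assert (H0 : x <> 0).
  { intros ->. apply (quadratic_neq_0 xi 275 (-87) H); [lia|].
    rewrite <- Hp. unfold cubic. ring. }
  assert (H1 : x - 1 <> 0).
  { intros E. apply (quadratic_neq_0 xi (-362) (-87) H); [lia|].
    rewrite <- Hp. replace x with ((x - 1) + 1) by ring. rewrite E. unfold cubic. ring. }
  assert (Hl : linear_factor xi x <> 0).
  { intros E. apply (quadratic_neq_0 xi (-16384) (-32768) H); [lia|].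
    transitivity (7 * cubic xi ((linear_factor xi x + 31 + 13 * xi) / 49)).
    - rewrite E. unfold cubic. field [H].
    - replace ((linear_factor xi x + 31 + 13 * xi) / 49) with x by (unfold linear_factor; field).
      rewrite Hp. ring. }
  assert (Z : 27 * (x * (x - 1) * linear_factor xi x ^ 7) = 0).
  { transitivity (49 * (27 / 49 * (x * (x - 1) * linear_factor xi x ^ 7))); [field|].
    rewrite HN. ring. }
  revert Z. apply Cmult_neq_0; [apply IZR_C_neq_0; lia|].
  apply Cmult_neq_0; [apply Cmult_neq_0; assumption|apply Cpow_nz, Hl].
Qed.

Lemma one_plus_2xi_neq_0 (xi : C) : xi ^ 2 = - xi - 2 -> 1 + 2 * xi <> 0.
Proof. intros H. apply (quadratic_neq_0 xi 1 2 H). lia. Qed.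

Definition phi2_map (xi : C) : P1 -> P1 := rational_map (phi2_num xi) (phi2_den xi) 9.

Lemma phi2_den_neq_0 (xi x : C) : xi ^ 2 = - xi - 2 ->
  poly_eval (phi2_den xi) x <> 0 <-> cubic xi x <> 0.
Proof.
  intros H. rewrite phi2_den_eval by exact H. split.
  - intros E E'. apply E. rewrite E'. ring.
  - intros E. apply Cmult_neq_0; [apply IZR_C_neq_0; lia|apply Cpow_nz, E].
Qed.

Lemma phi2_coprime (xi : C) : xi ^ 2 = - xi - 2 ->
  forall x, poly_eval (phi2_den xi) x = 0 -> poly_eval (phi2_num xi) x <> 0.
Proof.
  intros H x Hx. rewrite phi2_num_eval by exact H.
  apply Cmult_neq_0; [apply IZR_C_neq_0; lia|]. apply cubic_numer_coprime; [exact H|].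
  apply NNPP. intros E. apply (proj2 (phi2_den_neq_0 xi x H) E Hx).
Qed.

Lemma phi2_map_extension (xi : C) : xi ^ 2 = - xi - 2 -> P1_extension (phi2 xi) (phi2_map xi).
Proof.
  intros H. apply (rational_map_extension _ _ 8); try reflexivity.
  - apply IZR_C_neq_0. lia.
  - apply phi2_coprime, H.
  - intros x Hx. apply phi2_den_neq_0 in Hx; [|exact H].
    rewrite phi2_fraction, phi2_num_eval, phi2_den_eval by assumption. field. exact Hx.
Qed.

Lemma phi2_map_Some (xi x w : C) : xi ^ 2 = - xi - 2 ->
  phi2_map xi (Some x) = Some w <-> numer xi x - w * cubic xi x ^ 3 = 0.
Proof.
  intros H. unfold phi2_map.
  rewrite rational_map_Some; try exact (phi2_coprime xi H); try reflexivity.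
  rewrite phi2_num_eval, phi2_den_eval by exact H. split; intros E.
  - replace (numer xi x - w * cubic xi x ^ 3)
      with ((49 * numer xi x - w * (49 * cubic xi x ^ 3)) / 49) by field.
    rewrite E. field.
  - transitivity (49 * (numer xi x - w * cubic xi x ^ 3)); [ring|rewrite E; ring].
Qed.

(** Both coefficient lists end with 27 * 7^14. *)
Lemma phi2_map_None (xi : C) : phi2_map xi None = Some (RtoC 1).
Proof. simpl. f_equal. field. Qed.

Lemma phi2_map_covering (xi : C) : xi ^ 2 = - xi - 2 -> covering_of_degree (phi2_map xi) 9.
Proof.
  intros H. apply (rational_map_covering _ _ 8) with (B := [None; Some (RtoC 0); Some (RtoC 1)]);
    try reflexivity.
  - apply IZR_C_neq_0. lia.
  - apply phi2_coprime, H.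
  - now left.
  - right. right. left. symmetry. exact (phi2_map_None xi).
  - intros x w Hw E. apply (phi2_map_Some xi x w H) in Hw.
    assert (Hp : cubic xi x <> 0).
    { intros Z. apply (cubic_numer_coprime xi x H Z). rewrite Z in Hw. rewrite <- Hw. ring. }
    assert (EN : poly_eval_derive (phi2_num xi) x = 49 * numer1 xi x).
    { apply (is_derive_C_unique (poly_eval (phi2_num xi)) x); [apply is_derive_poly_eval|].
      apply (is_derive_C_ext_loc (fun x => 49 * numer xi x)).
      - apply filter_forall. intros z. symmetry. apply phi2_num_eval, H.
      - apply is_derive_C_scal, is_derive_numer. }
    assert (ED : poly_eval_derive (phi2_den xi) x = 49 * (3 * cubic xi x ^ 2 * cubic1 xi x)).
    { apply (is_derive_C_unique (poly_eval (phi2_den xi)) x); [apply is_derive_poly_eval|].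
      apply (is_derive_C_ext_loc (fun x => 49 * cubic xi x ^ 3)).
      - apply filter_forall. intros z. symmetry. apply phi2_den_eval, H.
      - apply is_derive_C_scal. eapply is_derive_C_eq.
        + apply is_derive_C_pow, is_derive_cubic.
        + rewrite !S_INR, !RtoC_plus. simpl INR. simpl Cpow. ring. }
    rewrite EN, ED in E.
    assert (Ew : w = numer xi x / cubic xi x ^ 3).
    { apply Ceq_minus in Hw. rewrite Hw. field. exact Hp. }
    (* The critical equation times 49 p becomes the numerator of phi2' by [numer_derive], with 1323
       = 49^2 * 27/49. A zero of [linear_factor] has value 0 and a zero of [quartic] has value 1. *)
    assert (Z : 1323 * (1 + 2 * xi) * (linear_factor xi x ^ 6 * quartic xi x) = 0).
    { transitivity (49 * cubic xi x * (49 * numer1 xi x - w * (49 * (3 * cubic xi x ^ 2 * cubic1 xi x)))).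
      - rewrite Ew. transitivity (49 * 49 * (numer1 xi x * cubic xi x - 3 * numer xi x * cubic1 xi x)).
        + rewrite numer_derive by exact H. field.
        + field. exact Hp.
      - rewrite E. ring. }
    destruct (Ceq_dec (linear_factor xi x) 0) as [L|L].
    { right. left. f_equal. rewrite Ew. unfold numer. rewrite L. field. exact Hp. }
    destruct (Ceq_dec (quartic xi x) 0) as [Q|Q].
    { right. right. left. f_equal. rewrite Ew.
      assert (T := cubic_minus_numer xi x H). rewrite Q in T.
      replace (numer xi x) with (cubic xi x ^ 3 - (cubic xi x ^ 3 - numer xi x)) by ring.
      rewrite T. field. exact Hp. }
    exfalso. revert Z. apply Cmult_neq_0.
    + apply Cmult_neq_0; [apply IZR_C_neq_0; lia|apply one_plus_2xi_neq_0, H].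
    + apply Cmult_neq_0; [apply Cpow_nz, L|exact Q].
Qed.

(** The bases of the powers in the two identities are the cubics normalized to be 1 at 0; the
    constant [k] drops out of the logarithmic derivative. *)
Lemma power_branch_scal_derive (f p p1 : C -> C) (k e x0 : C) (h : C -> C) :
  k <> 0 -> (forall x, f x = k * p x) -> (forall x, is_derive p x (p1 x)) ->
  power_branch f e x0 h ->
  locally x0 (fun x => p x <> 0 /\ is_derive h x (e * (p1 x / p x) * h x)).
Proof.
  intros Hk Hf Hp Hh. generalize (power_branch_derive f e x0 h Hh). apply filter_imp.
  intros x [Hx Hd].
  assert (Hpx : p x <> 0) by (intros E; apply Hx; rewrite Hf, E; ring).
  split; [exact Hpx|]. eapply is_derive_C_eq.
  - apply (Hd (k * p1 x)). apply (is_derive_C_ext_loc (fun x => k * p x)).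
    + apply filter_forall. intros z. symmetry. apply Hf.
    + apply is_derive_C_scal, Hp.
  - rewrite Hf. field. split; assumption.
Qed.

Lemma phi2_pullback (xi : C) : xi ^ 2 = - xi - 2 ->
  defines_pullback (phi2 xi) (1 / 84) (29 / 84) (6 / 7) (3 / 28) (17 / 28) (6 / 7).
Proof.
  intros H. split.
  - exists (phi2_num xi), (phi2_den xi). split.
    + do 9 right. left. apply IZR_C_neq_0. lia.
    + intros x. rewrite phi2_num_eval, phi2_den_eval by exact H.
      unfold phi2. fold (linear_factor xi x). unfold numer.
      change (7203 * x ^ 3 + (9947 * xi - 5831) * x ^ 2 - (9947 * xi + 2009) * x + 275 - 87 * xi)
        with (cubic xi x).
      (* The denominators are the same term, so comparing numerators proves the equality at the
         poles as well. *)
      unfold Cdiv. f_equal. field.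
  - exists [(cubic xi, - (1 / 28))]. split.
    + constructor; [|constructor]. split.
      * exists [275 - 87 * xi; - (9947 * xi + 2009); 9947 * xi - 5831; RtoC 7203], [RtoC 1].
        split; [left; exact C1_nz|]. intros x. unfold cubic. simpl. field.
      * exists 0. simpl. intros E. apply (quadratic_neq_0 xi 275 (-87) H); [lia|].
        rewrite <- E. unfold cubic. ring.
    + intros x0 theta y _ _ _ [h [theta' [Hh [Ht' Ht]]]] Hy. simpl in Ht'.
      apply (pullback_phi2 xi); [exact H| |exact Hy].
      assert (E : locally x0 (fun x => h x = theta x)).
      { generalize (filter_and _ _ Ht' Ht). apply filter_imp. intros x [E1 E2].
        rewrite E2, E1. ring. }
      apply locally_locally in E.
      assert (Hd := power_branch_scal_derive (cubic xi) (cubic xi) (cubic1 xi) 1 _ _ _ C1_nz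
                      ltac:(intros; ring) (is_derive_cubic xi) Hh).
      generalize (filter_and _ _ E Hd). apply filter_imp. intros x [Ex [Hp Hx]].
      split; [exact Hp|]. split; [apply phi2_fraction, Hp|].
      rewrite <- (locally_singleton _ _ Ex).
      exact (is_derive_C_ext_loc _ _ _ _ Ex Hx).
Qed.

(** Turns the rational parameters into images of real numbers, as the existence and uniqueness
    lemmas for [hyp2F1] require. *)
Lemma Cdiv_RtoC (p q : Z) : q <> 0%Z -> RtoC (IZR p) / RtoC (IZR q) = RtoC (IZR p / IZR q)%R.
Proof. intros H. rewrite RtoC_div; [reflexivity|]. intros E. apply eq_IZR in E. contradiction. Qed.

Lemma phi2_hyp2F1_0 (xi : C) (h : C -> C) : xi ^ 2 = - xi - 2 ->
  power_branch
    (fun x => 1 + 7 * (10 - 29 * xi) / 8 * x - 343 * (50 - 29 * xi) / 512 * x ^ 2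
              + 1029 * (362 + 87 * xi) / 16384 * x ^ 3) (- (1 / 28)) 0 h ->
  h 0 = 1 ->
  locally (0 : C) (fun x => exists w : C, phi2_map xi (Some x) = Some w /\
    hyp2F1 (3 / 28) (17 / 28) (6 / 7) x = h x * hyp2F1 (1 / 84) (29 / 84) (6 / 7) w).
Proof.
  intros H Hh Hh0.
  assert (Hc : 275 - 87 * xi <> 0).
  { replace (275 - 87 * xi) with (RtoC (IZR 275) + RtoC (IZR (-87)) * xi) by ring.
    apply quadratic_neq_0; [exact H|lia]. }
  assert (Hd : locally (0 : C) (fun x => cubic xi x <> 0 /\
    is_derive h x (- (1 / 28) * (cubic1 xi x / cubic xi x) * h x))).
  (* 275 - 87 xi is the value of the cubic at 0. Its norm is 7 * 2^14, whence the powers of 2 in the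
     denominators of the normalized polynomial. *)
  { refine (power_branch_scal_derive _ (cubic xi) (cubic1 xi) (/ (275 - 87 * xi)) _ _ h
              _ _ (is_derive_cubic xi) Hh).
    - intros E. apply C1_nz. rewrite <- (Cinv_l _ Hc), E. ring.
    - intros x. apply Ceq_minus.
      match goal with |- ?l - / ?k * ?r = _ => transitivity (/ k * (k * l - r)); [field; exact Hc|] end.
      match goal with |- _ * ?m = _ => replace m with (RtoC 0); [ring|] end.
      unfold cubic. field [H]. }
  set (phi := fun x => numer xi x / cubic xi x ^ 3).
  assert (phi0 : phi 0 = 0).
  { unfold phi, numer. unfold Cdiv. ring. }
  assert (Hs : solves_hypergeometric_near (3 / 28) (17 / 28) (6 / 7) 0
            (fun x => h x * hyp2F1 (1 / 84) (29 / 84) (6 / 7) (phi x))).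
  { apply (pullback_phi2 xi); [exact H| |].
    - revert Hd. apply filter_imp. intros x [Hp Hx]. split; [exact Hp|split; [reflexivity|exact Hx]].
    - rewrite phi0, !Cdiv_RtoC by lia. apply hyp2F1_solves; lra. }
  rewrite (Cdiv_RtoC 3 28), (Cdiv_RtoC 17 28), (Cdiv_RtoC 6 7) in Hs |- * by lia.
  apply solves_hypergeometric_2F1 in Hs; try lra.
  - generalize (filter_and _ _ Hd Hs). apply filter_imp. intros x [[Hp _] E].
    exists (phi x). split; [|exact E].
    apply phi2_map_Some; [exact H|]. unfold phi. field. exact Hp.
  - cbv beta. rewrite phi0, Hh0, hyp2F1_0. ring.
Qed.

Lemma phi2_map_inv (xi x : C) : xi ^ 2 = - xi - 2 -> cubic_rev xi x <> 0 ->
  phi2_map xi (P1_inv x) = Some (1 - numer_rev xi x / cubic_rev xi x ^ 3).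
Proof.
  intros H Hp. unfold P1_inv. destruct (Ceq_dec x 0) as [->|Hx].
  (* At x = 0 the inverse is infinity, with value 1, in accordance with the factor x of
     [numer_rev]. *)
  - rewrite phi2_map_None. f_equal. unfold numer_rev, Cdiv. ring.
  - apply phi2_map_Some; [exact H|].
    assert (Ep : cubic xi (/ x) = cubic_rev xi x / x ^ 3).
    { unfold cubic, cubic_rev. field. exact Hx. }
    assert (Eq : quartic xi (/ x) = quartic_rev xi x / x ^ 4).
    { unfold quartic, quartic_rev. field. exact Hx. }
    assert (T := cubic_minus_numer xi (/ x) H).
    replace (numer xi (/ x)) with (cubic xi (/ x) ^ 3 - (cubic xi (/ x) ^ 3 - numer xi (/ x))) by ring.
    rewrite T, Ep, Eq. unfold numer_rev. field. split; assumption.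
Qed.

Lemma phi2_hyp2F1_inv (xi : C) (h : C -> C) : xi ^ 2 = - xi - 2 ->
  power_branch
    (fun x => 1 - (17 - 29 * xi) / 21 * x - (41 + 203 * xi) / 147 * x ^ 2
              + (275 - 87 * xi) / 7203 * x ^ 3) (- (1 / 28)) 0 h ->
  h 0 = 1 ->
  locally (0 : C) (fun x => exists w : C, phi2_map xi (P1_inv x) = Some w /\
    hyp2F1 (3 / 28) (1 / 4) (1 / 2) x = h x * hyp2F1 (1 / 84) (29 / 84) (1 / 2) (1 - w)).
Proof.
  intros H Hh Hh0.
  assert (Hd : locally (0 : C) (fun x => cubic_rev xi x <> 0 /\
    is_derive h x (- (1 / 28) * (cubic_rev1 xi x / cubic_rev xi x) * h x))).
  { refine (power_branch_scal_derive _ (cubic_rev xi) (cubic_rev1 xi) (/ 7203) _ _ h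
              _ _ (is_derive_cubic_rev xi) Hh).
    - intros E. apply C1_nz. rewrite <- (Cinv_l 7203), E by (apply IZR_C_neq_0; lia). ring.
    - intros x. unfold cubic_rev. field. }
  set (phi := fun x => numer_rev xi x / cubic_rev xi x ^ 3).
  assert (phi0 : phi 0 = 0).
  { unfold phi, numer_rev. unfold Cdiv. ring. }
  assert (Hs : solves_hypergeometric_near (3 / 28) (1 / 4) (1 / 2) 0
            (fun x => h x * hyp2F1 (1 / 84) (29 / 84) (1 / 2) (phi x))).
  { apply (pullback_phi2_inv xi); [exact H| |].
    - revert Hd. apply filter_imp. intros x [Hp Hx]. split; [exact Hp|split; [reflexivity|exact Hx]].
    - rewrite phi0, !Cdiv_RtoC by lia. apply hyp2F1_solves; lra. }
  rewrite (Cdiv_RtoC 3 28), (Cdiv_RtoC 1 4), (Cdiv_RtoC 1 2) in Hs |- * by lia.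
  apply solves_hypergeometric_2F1 in Hs; try lra.
  - generalize (filter_and _ _ Hd Hs). apply filter_imp. intros x [[Hp _] E].
    exists (1 - phi x). split; [apply phi2_map_inv; assumption|].
    replace (1 - (1 - phi x)) with (phi x) by ring. exact E.
  - cbv beta. rewrite phi0, Hh0, hyp2F1_0. ring.
Qed.

Theorem mainTheorem3 (xi : C) (hxi : xi ^ 2 + xi + 2 = 0) :
  exists Phi : P1 -> P1,
    P1_extension (phi2 xi) Phi /\
    covering_of_degree Phi 9 /\
    (exists a b c a' b' c' : C,
       has_exponent_differences a b c [1 / 2; 1 / 3; 1 / 7] /\
       has_exponent_differences a' b' c' [1 / 2; 1 / 7; 1 / 7] /\
       defines_pullback (phi2 xi) a b c a' b' c') /\
    (exists h : C -> C,
       power_branch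
         (fun x => 1 + 7 * (10 - 29 * xi) / 8 * x
                   - 343 * (50 - 29 * xi) / 512 * x ^ 2
                   + 1029 * (362 + 87 * xi) / 16384 * x ^ 3)
         (- (1 / 28)) 0 h /\
       h 0 = 1 /\
       locally (0 : C) (fun x =>
         exists w : C,
           Phi (Some x) = Some w /\
           hyp2F1 (3 / 28) (17 / 28) (6 / 7) x =
           h x * hyp2F1 (1 / 84) (29 / 84) (6 / 7) w)) /\
    (exists h : C -> C,
       power_branch
         (fun x => 1 - (17 - 29 * xi) / 21 * x
                   - (41 + 203 * xi) / 147 * x ^ 2
                   + (275 - 87 * xi) / 7203 * x ^ 3)
         (- (1 / 28)) 0 h /\
       h 0 = 1 /\
       locally (0 : C) (fun x =>
         exists w : C,
           Phi (P1_inv x) = Some w /\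
           hyp2F1 (3 / 28) (1 / 4) (1 / 2) x =
           h x * hyp2F1 (1 / 84) (29 / 84) (1 / 2) (1 - w))).
Proof.
  assert (H : xi ^ 2 = - xi - 2).
  { transitivity (xi ^ 2 + xi + 2 - xi - 2); [ring|rewrite hxi; ring]. }
  exists (phi2_map xi). split; [apply phi2_map_extension, H|].
  split; [apply phi2_map_covering, H|]. split; [|split].
  - exists (1 / 84), (29 / 84), (6 / 7), (3 / 28), (17 / 28), (6 / 7).
    split; [|split; [|apply phi2_pullback, H]].
    (* The differences c - a - b, a - b, 1 - c are 1/2, -1/3, 1/7: a rotation of the defining order,
       with one sign to change. *)
    + exists [6 / 7 - 1 / 84 - 29 / 84; 1 / 84 - 29 / 84; 1 - 6 / 7]. split.
      * apply (Permutation_app_comm [1 - 6 / 7]).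
      * constructor; [left; field|]. constructor; [right; field|].
        constructor; [left; field|constructor].
    + exists [3 / 28 - 17 / 28; 1 - 6 / 7; 6 / 7 - 3 / 28 - 17 / 28]. split.
      * apply (Permutation_app_comm [1 - 6 / 7; 6 / 7 - 3 / 28 - 17 / 28]).
      * constructor; [right; field|]. constructor; [left; field|].
        constructor; [left; field|constructor].
  - match goal with |- exists h, power_branch ?f ?e _ _ /\ _ =>
      destruct (power_branch_exists f e 0) as [h [Hh Hh0]] end.
    + cbv beta. simpl Cpow. unfold Cdiv. ring.
    + apply filter_forall. intros x. eexists. derive_polynomial.
    + exists h. split; [exact Hh|]. split; [exact Hh0|]. apply phi2_hyp2F1_0; assumption.
  - match goal with |- exists h, power_branch ?f ?e _ _ /\ _ =>
      destruct (power_branch_exists f e 0) as [h [Hh Hh0]] end.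
    + cbv beta. simpl Cpow. unfold Cdiv. ring.
    + apply filter_forall. intros x. eexists. derive_polynomial.
    + exists h. split; [exact Hh|]. split; [exact Hh0|]. apply phi2_hyp2F1_inv; assumption.
Qed.
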